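(* Fix an integer $k \ge 4$. The algorithm Approx1 (defined in the context) runs in $O(|V|^{k+1})$ time on an input graph $G=(V,E)$ and is a $\rho(k)$-approximation algorithm for the Max-$k$ path cover problem, where \[ \rho(k) = \begin{cases} \frac{3k+1}{2} - \frac14\sqrt{18k^2-3}, & \text{if $k$ is odd},\\ \frac{3k+1}{2} - \frac14\sqrt{18k^2-21}, & \text{if $k$ is even}.\end{cases} \] That is, for every input graph and every execution of the algorithm, the returned collection consists of vertex-disjoint paths of order at least $k$ and covers at least $\mathrm{OPT}/\rho(k)$ vertices, where $\mathrm{OPT}$ is the maximum number of vertices coverable by a collection of vertex-disjoint paths of order at least $k$. In particular, for $k=4$ Approx1 is a $2.4$-approximation algorithm, and the ratio $2.4$ is tight: there is an input graph and an execution of Approx1 (for $k=4$) whose output covers exactly $\mathrm{OPT}/2.4$ vertices.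
   Context: All graphs are simple and undirected; $G=(V,E)$ is the input graph and $n=|V|$. The order of a path is its number of vertices; an $\ell$-path is a path of order $\ell$. For a fixed integer $k\ge 4$, the Max-$k$ path cover problem asks, given $G$, for a collection of vertex-disjoint paths in $G$, each of order at least $k$, covering (i.e. having in the union of their vertex sets) the maximum number of vertices. Vertex naming on a path: for a path $P$ of order $\ell\ge 4$, pick one endpoint; $u_j$ denotes the vertex of $P$ at distance $j$ from that endpoint ($0\le j\le \lceil \ell/2\rceil-1$) and $v_j$ the vertex at distance $j$ from the other endpoint ($0\le j\le \lfloor \ell/2\rfloor -1$). Either endpoint may be chosen as $u_0$. For a collection $\mathcal{P}$ of vertex-disjoint paths, $V(\mathcal{P})$ is the union of their vertex sets. Let $R=V\setminus V(\mathcal{P})$. For $v\in V(\mathcal{P})$, an extension $e(v)$ at $v$ is a path in the induced subgraph $G[R]$ having an endpoint adjacent to $v$ in $G$ (the empty path, of order $0$, is also allowed as an extension); $n(e(v))$ is its order, and $n(v)$ is the maximum order of an extension at $v$. Operations on the current collection $\mathcal{P}$: (Add) If $G[V\setminus V(\mathcal{P})]$ contains a $k$-path, add it to $\mathcal{P}$. (Rep) If for some $P\in\mathcal{P}$ there is an index $t$ and an extension $e(u_t)$ with $n(e(u_t))\ge t+1$, replace the prefix $u_0$-$u_1$-$\cdots$-$u_{t-1}$ of $P$ by $e(u_t)$ (attached to $u_t$ via its endpoint adjacent to $u_t$); symmetrically for $v_t$ and the suffix $v_{t-1}$-$\cdots$-$v_0$. (DoubleRep) For $P\in\mathcal{P}$: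 (i) if there are indices $t$ and $j\ge t+1$ and vertex-disjoint extensions $e(u_t)$, $e(u_j)$ with $n(e(u_t))\ge k-(t+1)$ and $n(e(u_j))\ge k-(n(P)-j)$, replace $P$ by the two paths $u_0$-$\cdots$-$u_t$-$e(u_t)$ and $e(u_j)$-$u_j$-$\cdots$-$v_1$-$v_0$; or (ii) if there are indices $t,j$ and vertex-disjoint extensions $e(u_t)$, $e(v_j)$ with $n(e(u_t))\ge k-(t+1)$ and $n(e(v_j))\ge k-(j+1)$, replace $P$ by $u_0$-$\cdots$-$u_t$-$e(u_t)$ and $e(v_j)$-$v_j$-$\cdots$-$v_1$-$v_0$. Algorithm Approx1: start with $\mathcal{P}=\emptyset$; while one of Add, Rep, DoubleRep is applicable, apply one such operation, and then break every path of order $2k$ or more into two paths, one of which is a $k$-path (by deleting an edge); when none is applicable, return $\mathcal{P}$. Thus every path of $\mathcal{P}$ always has order between $k$ and $2k-1$. *)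

(* Defs.v *)
(* Mathematical Components. *)
From Stdlib Require Import Relation_Operators.
From mathcomp Require Import all_boot all_order all_algebra.
Set Implicit Arguments.
Unset Strict Implicit.
Unset Printing Implicit Defensive.

Record sgraph (T : finType) := SGraph {
  adj : rel T;
  adj_sym : symmetric adj;
  adj_irrefl : irreflexive adj
}.

Section PathCover.
Variables (T : finType) (G : sgraph T).

(* A path is given by one of its two vertex sequences; the empty sequence is
   the empty path.  Its order is [size p]. *)
Definition is_path (p : seq T) : bool := uniq p && sorted (adj G) p.

(* A finite collection of paths; its listing order and the orientation of its
   members carry no information. *)
Definition coll := seq (seq T).

Definition covered (P : coll) : {set T} := [set x in flatten P].

(* [uniq (flatten P)] is vertex-disjointness, the members being nonempty and
   themselves repetition-free. *)
Definition path_cover (k : nat) (P : coll) : Prop :=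
  [/\ {in P, forall p, is_path p}, {in P, forall p, k <= size p}
    & uniq (flatten P)].

Definition is_opt (k m : nat) : Prop :=
  (exists2 P, path_cover k P & #|covered P| = m) /\
  (forall P, path_cover k P -> #|covered P| <= m).

(* The vertices u_t and v_t of a path oriented so that its head is u_0; they
   are defined for t < ceil(l/2), resp. t < floor(l/2), l being the order. *)
Definition u_vtx (q : seq T) (t : nat) : option T :=
  if t < uphalf (size q) then onth q t else None.

Definition v_vtx (q : seq T) (t : nat) : option T :=
  if t < (size q)./2 then onth (rev q) t else None.

Definition in_rest (P : coll) (x : seq T) : bool :=
  all (fun z => z \notin covered P) x.

(* An extension is listed from its endpoint adjacent to v. *)
Definition extension (P : coll) (v : T) (x : seq T) : bool :=
  [&& is_path x, in_rest P x & path (adj G) v x].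

(* [q] is the path being modified, oriented so that its head is u_0. *)
Inductive rep (P : coll) (q : seq T) : seq T -> Prop :=
| RepU t v x of u_vtx q t = Some v & extension P v x & t.+1 <= size x :
    rep P q (rev x ++ drop t q)
| RepV t v x of v_vtx q t = Some v & extension P v x & t.+1 <= size x :
    rep P q (take (size q - t) q ++ x).

(* The inequalities n(e) >= k - m are written k <= m + n(e), so that no
   truncated subtraction occurs. *)
Inductive double_rep (k : nat) (P : coll) (q : seq T) :
    seq T -> seq T -> Prop :=
| DoubleRepUU t j a b x y of
      u_vtx q t = Some a & u_vtx q j = Some b & t.+1 <= j
    & extension P a x & extension P b y & ~~ has (mem x) y
    & k <= t.+1 + size x & k <= (size q - j) + size y :
    double_rep k P q (take t.+1 q ++ x) (rev y ++ drop j q)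
| DoubleRepUV t j a b x y of
      u_vtx q t = Some a & v_vtx q j = Some b
    & extension P a x & extension P b y & ~~ has (mem x) y
    & k <= t.+1 + size x & k <= j.+1 + size y :
    double_rep k P q (take t.+1 q ++ x) (rev y ++ drop (size q - j.+1) q).

Inductive operation (k : nat) (P : coll) : coll -> Prop :=
| OpAdd p of is_path p & size p = k & in_rest P p :
    operation k P (p :: P)
| OpRep p q S q' of perm_eq P (p :: S) & q = p \/ q = rev p
    & rep P q q' :
    operation k P (q' :: S)
| OpDoubleRep p q S q1 q2 of perm_eq P (p :: S) & q = p \/ q = rev p
    & double_rep k P q q1 q2 :
    operation k P [:: q1, q2 & S].

Inductive break (k : nat) (P : coll) : coll -> Prop :=
| Break a b S of perm_eq P ((a ++ b) :: S) & 2 * k <= size (a ++ b)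
    & size a = k \/ size b = k :
    break k P [:: a, b & S].

(* One round of the main loop: an operation, then breaking until no path of
   order at least 2k is left. *)
Definition round (k : nat) (P Q : coll) : Prop :=
  exists P1 P2 : coll,
    [/\ operation k P P1, clos_refl_trans coll (break k) P1 P2,
        all (fun p => size p < 2 * k) P2 & perm_eq P2 Q].

(* [execution k tr P]: some partial execution of Approx1 goes through the
   collections listed in [tr], starting with the empty one and ending in [P]. *)
Inductive execution (k : nat) : seq coll -> coll -> Prop :=
| ExecStart : execution k [:: [::]] [::]
| ExecRound tr P Q of execution k tr P & round k P Q :
    execution k (rcons tr Q) Q.

Definition complete_execution (k : nat) (tr : seq coll) (P : coll) : Prop :=
  execution k tr P /\ ~ exists Q, operation k P Q.

Definition returns (k : nat) (P : coll) : Prop :=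
  exists tr, complete_execution k tr P.

End PathCover.

(* Every execution halts. *)
Definition terminating (k : nat) : Prop :=
  forall (T : finType) (G : sgraph T),
    ~ exists P : nat -> coll T, P 0 = [::] /\ forall i, round G k (P i) (P i.+1).

Section CostModel.
(* Unit-cost random access machine programs, in structured form.  The memory
   consists of arrays named by constants, with indirect indexing (a scalar
   variable is a cell of an array at a constant index); there is a write-only
   output tape.  The input is an n-vertex graph, given by its number of
   vertices and its adjacency matrix.  The only arithmetic operations are
   successor and predecessor: every number occurring in a run of t steps is
   at most n + t plus a constant depending on the program, so words of
   logarithmic length suffice for a polynomial-time run. *)

Inductive expr :=
| ECst of nat
| EOrder
| EGet of nat & expr
| ESucc of expr
| EPred of expr
| EEq of expr & expr
| ELt of expr & expr
| EAdj of expr & expr.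

Inductive cmd :=
| CSkip
| CSet of nat & expr & expr
| CWrite of expr
| CSeq of cmd & cmd
| CIf of expr & cmd & cmd
| CWhile of expr & cmd.

Definition memory := nat -> nat -> nat.

Definition update (M : memory) (a i x : nat) : memory :=
  fun b j => if (b == a) && (j == i) then x else M b j.

Variables (n : nat) (G : sgraph 'I_n).

Definition adj_nat (i j : nat) : bool :=
  match (insub i : option 'I_n), (insub j : option 'I_n) with
  | Some x, Some y => adj G x y
  | _, _ => false
  end.

Fixpoint eval (M : memory) (e : expr) : nat :=
  match e with
  | ECst c => c
  | EOrder => n
  | EGet a i => M a (eval M i)
  | ESucc e1 => (eval M e1).+1
  | EPred e1 => (eval M e1).-1
  | EEq e1 e2 => eval M e1 == eval M e2
  | ELt e1 e2 => eval M e1 < eval M e2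
  | EAdj e1 e2 => adj_nat (eval M e1) (eval M e2)
  end.

Fixpoint cost (e : expr) : nat :=
  match e with
  | ECst _ | EOrder => 1
  | EGet _ e1 | ESucc e1 | EPred e1 => (cost e1).+1
  | EEq e1 e2 | ELt e1 e2 | EAdj e1 e2 => (cost e1 + cost e2).+1
  end.

(* [run c s t s']: from the state [s] (memory and output tape), the program
   [c] halts in the state [s'] after [t] steps. *)
Inductive run : cmd -> memory * seq nat -> nat -> memory * seq nat -> Prop :=
| RunSkip s : run CSkip s 1 s
| RunSet M o a i e :
    run (CSet a i e) (M, o) (cost i + cost e).+1
      (update M a (eval M i) (eval M e), o)
| RunWrite M o e :
    run (CWrite e) (M, o) (cost e).+1 (M, rcons o (eval M e))
| RunSeq c1 c2 s1 s2 s3 t1 t2 of run c1 s1 t1 s2 & run c2 s2 t2 s3 :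
    run (CSeq c1 c2) s1 (t1 + t2).+1 s3
| RunIfTrue e c1 c2 s s' t of eval s.1 e != 0 & run c1 s t s' :
    run (CIf e c1 c2) s (cost e + t).+1 s'
| RunIfFalse e c1 c2 s s' t of eval s.1 e = 0 & run c2 s t s' :
    run (CIf e c1 c2) s (cost e + t).+1 s'
| RunWhileTrue e c s1 s2 s3 t1 t2 of eval s1.1 e != 0
    & run c s1 t1 s2 & run (CWhile e c) s2 t2 s3 :
    run (CWhile e c) s1 (cost e + t1 + t2).+1 s3
| RunWhileFalse e c s of eval s.1 e = 0 :
    run (CWhile e c) s (cost e).+1 s.

(* The vertices are the numbers below n; n ends a path and n+1 a collection. *)
Definition encode_path (p : seq 'I_n) : seq nat :=
  rcons [seq nat_of_ord x | x <- p] n.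

Definition encode_coll (P : coll 'I_n) : seq nat :=
  rcons (flatten [seq encode_path p | p <- P]) n.+1.

Definition encode_trace (tr : seq (coll 'I_n)) : seq nat :=
  flatten [seq encode_coll P | P <- tr].

End CostModel.

(* Approx1 is implemented by a program (depending on the constant k only) that
   carries out a complete execution, writing the successive collections, the
   last one being the collection returned, in O(f(n)) steps.  The additive
   constant only matters when f vanishes, as on the empty graph. *)
Definition runs_in_time (k : nat) (f : nat -> nat) : Prop :=
  exists (prog : cmd) (c : nat), forall (n : nat) (G : sgraph 'I_n),
    exists (tr : seq (coll 'I_n)) (P : coll 'I_n) (t : nat) (M : memory),
      [/\ complete_execution G k tr P,
          run G prog (fun _ _ => 0, [::]) t (M, encode_trace tr)
        & t <= c * f n + c].

Import GRing.Theory Num.Theory.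
Local Open Scope ring_scope.

Definition approximation_ratio (R : rcfType) (k : nat) (r : R) : Prop :=
  forall (T : finType) (G : sgraph T) (P : coll T), returns G k P ->
    path_cover G k P /\
    forall opt : nat, is_opt G k opt -> opt%:R / r <= #|covered P|%:R.

(* Instances with optimum 0 would make tightness trivial. *)
Definition ratio_attained (R : rcfType) (k : nat) (r : R) : Prop :=
  exists (T : finType) (G : sgraph T) (P : coll T) (opt : nat),
    [/\ returns G k P, is_opt G k opt, (0 < opt)%N
      & #|covered P|%:R = opt%:R / r].

Definition rho (R : rcfType) (k : nat) : R :=
  (3 * k%:R + 1) / 2 -
    1 / 4 * Num.sqrt (18 * k%:R ^+ 2 - (if odd k then 3 else 21)).

(* Main.v *)
(* Ratio.  Fix an output P, where no operation applies, and an optimum Q, and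
   let the vertices of V(P) cut the paths of Q into stretches outside V(P).  A
   stretch is charged in halves to the two vertices next to it, and entirely to
   its neighbour if it ends a path of Q.  At a vertex of depth d (distance to
   the nearer end of its path in P) every stretch is an extension, hence of
   order at most d.  If it is also of order at most k - 2 - d, then the vertex
   receives at most 3/2 min (d, k - 2 - d), since two final stretches would make
   a path of Q of order below k.  Two vertices of the same path with longer
   stretches would allow DoubleRep unless they share that stretch, so one vertex
   receiving 2d is the worst case.  Summing over a path of order l gives a bound
   a l - 3 l^2 / 8 - c, whose quotient by l is maximized by AM-GM.

   Running time.  Every operation increases the number of covered vertices, so
   there are at most n rounds.  If Add and Rep do not apply, then the extensions
   of a DoubleRep may be cut to order at most (k - 1) / 2 each.  Hence an
   operation is determined, up to finitely many shapes, by k numbers below n: k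
   vertices, or the number of a path and at most k - 1 vertices; k nested loops
   find it. *)

(* DoubleRep gains vertices only because long paths are broken: it makes two paths of order at least
   k out of one of order below 2k. The quadratic bound for a path is exact for odd l, which produces
   the constants 3 and 21 under the root. Its real maximizer need not be an integer: rho (4) is
   about 2.415, so the ratio 2.4 needs the exact values for the orders 4, ..., 7, and order 5, where
   it is reached, dictates the tight instance. For the running time, no loop is left early: once an
   operation has been performed, the remaining attempts of the round do nothing. So every loop makes
   n iterations, and the exponent k + 1 is the nesting depth of the program. *)
Require Import Defs.
From Stdlib Require Import Relation_Operators.
From mathcomp Require Import all_boot all_order all_algebra.
From mathcomp Require Import zify ring lra.
Set Implicit Arguments.
Unset Strict Implicit.
Unset Printing Implicit Defensive.

(** * Operations and their effect *)

(* [lia] compares atoms syntactically and does not see that the two spellings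
   of the carrier of a finType are convertible. *)
Ltac slia :=
  repeat match goal with
  | |- context [@size (Equality.sort (fintype_Finite__to__eqtype_Equality ?T)) ?s] =>
      progress change (@size (Equality.sort (fintype_Finite__to__eqtype_Equality T)) s)
        with (@size (Finite.sort T) s)
  | H : context [@size (Equality.sort (fintype_Finite__to__eqtype_Equality ?T)) ?s] |- _ =>
      progress change (@size (Equality.sort (fintype_Finite__to__eqtype_Equality T)) s)
        with (@size (Finite.sort T) s) in H
  end; lia.

Section LocalSearch.
Variables (T : finType) (G : sgraph T).
Implicit Types (P Q S : coll T) (p q x y : seq T).

Lemma mem_covered P v : (v \in covered P) = (v \in flatten P).
Proof. by rewrite inE. Qed.

Lemma in_restE P x : in_rest P x = all (fun z => z \notin flatten P) x.
Proof. by apply: eq_all => z; rewrite mem_covered. Qed.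

Lemma onth_lt q t v : onth q t = Some v -> t < size q.
Proof. by move=> tv; rewrite -onthTE tv. Qed.

Lemma nth_onth v0 q t v : onth q t = Some v -> nth v0 q t = v.
Proof. exact: onth_nth. Qed.

Lemma onth_drop q t v : onth q t = Some v -> drop t q = v :: drop t.+1 q.
Proof. by move=> tv; rewrite (drop_nth v (onth_lt tv)) (nth_onth v tv). Qed.

Lemma onth_take q t v : onth q t = Some v -> take t.+1 q = rcons (take t q) v.
Proof. by move=> tv; rewrite (take_nth v (onth_lt tv)) (nth_onth v tv). Qed.

Lemma onth_mem q t v : onth q t = Some v -> v \in q.
Proof. by move=> tv; rewrite -(nth_onth v tv) mem_nth // (onth_lt tv). Qed.

Lemma onth_lt_ex q t : t < size q -> exists v, onth q t = Some v.
Proof. by rewrite -onthTE; case: onth => // v _; exists v. Qed.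

Lemma onth_rev q t v :
  onth q t = Some v -> onth (rev q) (size q - t.+1) = Some v.
Proof.
move=> tv; have ltq := onth_lt tv.
have [|w] := @onth_lt_ex (rev q) (size q - t.+1); first by rewrite size_rev; slia.
move=> hw; rewrite hw -(nth_onth v hw) nth_rev; last by slia.
by rewrite (_ : size q - _ = t) ?(nth_onth v tv) //; slia.
Qed.

Lemma is_path_rev p : is_path G (rev p) = is_path G p.
Proof.
rewrite /is_path rev_uniq rev_sorted; congr (_ && _).
by apply: eq_sorted => a b; rewrite adj_sym.
Qed.

Lemma is_path_cat p q : is_path G (p ++ q) -> is_path G p /\ is_path G q.
Proof.
rewrite /is_path cat_uniq => /andP[/and3P[-> _ ->] /cat_sorted2[-> ->]].
by [].
Qed.

Lemma is_path_take n p : is_path G p -> is_path G (take n p).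
Proof. by move=> pp; have [] := @is_path_cat (take n p) (drop n p); rewrite ?cat_take_drop. Qed.

Lemma is_path_drop n p : is_path G p -> is_path G (drop n p).
Proof. by move=> pp; have [] := @is_path_cat (take n p) (drop n p); rewrite ?cat_take_drop. Qed.

Lemma is_path_join p v x : is_path G (rcons p v) -> is_path G x ->
  path (adj G) v x -> ~~ has (mem (rcons p v)) x -> is_path G (rcons p v ++ x).
Proof.
move=> /andP[up sp] /andP[ux sx] px hx.
rewrite /is_path cat_uniq up ux hx /=.
case: p sp {up hx} => [|a p] //=; rewrite cat_path last_rcons => -> //.
Qed.

Lemma extension_take P v x n : extension G P v x -> extension G P v (take n x).
Proof.
case/and3P=> px rx vx; apply/and3P; split; first exact: is_path_take.
- by apply/allP => z /mem_take zx; apply: (allP rx).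
- by move: vx; rewrite -{1}(cat_take_drop n x) cat_path => /andP[].
Qed.

Lemma extensionP P v x : extension G P v x ->
  [/\ is_path G x, path (adj G) v x & forall z, z \in x -> z \notin flatten P].
Proof.
case/and3P=> px rx vx; split=> // z zx.
by move/allP: rx => /(_ _ zx); rewrite mem_covered.
Qed.

Definition oriented p q := q = p \/ q = rev p.

Lemma oriented_trans p q x : oriented p q -> oriented q x -> oriented p x.
Proof. by move=> [->|->] [->|->]; rewrite ?revK; [left|right|right|left]. Qed.

Lemma oriented_size p q : oriented p q -> size q = size p.
Proof. by case=> ->; rewrite ?size_rev. Qed.

Lemma oriented_mem p q : oriented p q -> q =i p.
Proof. by case=> -> z; rewrite ?mem_rev. Qed.

Lemma oriented_path p q : oriented p q -> is_path G q = is_path G p.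
Proof. by case=> ->; rewrite ?is_path_rev. Qed.

(** Rep at v_t is Rep at u_t on the reversed path, so one index and an orientation describe both
    forms. *)
Variant rep_spec P q q' : Prop :=
  RepSpec r t v x of oriented q r & oriented (rev x ++ drop t r) q'
    & onth r t = Some v & t < uphalf (size r) & extension G P v x & t < size x.

Lemma repP P q q' : rep G P q q' -> rep_spec P q q'.
Proof.
case=> t v x; rewrite /u_vtx /v_vtx; case: ifP => // tq tv ex tx.
  by apply: (@RepSpec _ _ _ q t v x) => //; left.
apply: (@RepSpec _ _ _ (rev q) t v x) => //; first by right.
- by right; rewrite rev_cat revK drop_rev revK.
- by rewrite size_rev uphalfE; apply: (leq_trans tq); rewrite half_leq.
Qed.

(** The vertex v_j has index [size q - j.+1], so the two forms of DoubleRep become one when the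
    second index runs over the whole path. *)
Variant double_rep_spec k P q q1 q2 : Prop :=
  DoubleRepSpec t j a b x y of t < uphalf (size q) & t < j
    & onth q t = Some a & onth q j = Some b
    & extension G P a x & extension G P b y & ~~ has (mem x) y
    & k <= t.+1 + size x & k <= size q - j + size y
    & q1 = take t.+1 q ++ x & q2 = rev y ++ drop j q.

Lemma double_repP k P q q1 q2 : double_rep G k P q q1 q2 <-> double_rep_spec k P q q1 q2.
Proof.
split.
  case=> t j a b x y; rewrite /u_vtx /v_vtx; case: ifP => // tq ta.
    case: ifP => // jq jb tj ea eb xy kx ky.
    exact: (@DoubleRepSpec _ _ _ _ _ t j a b x y).
  case: ifP => // jq jb ea eb xy kx ky.
  have jq' : j < size q by slia.
  apply: (@DoubleRepSpec _ _ _ _ _ t (size q - j.+1) a b x y) => //; first by slia.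
  - by have := onth_rev jb; rewrite revK size_rev.
  - by slia.
case=> t j a b x y tq tj ta jb ea eb xy kx ky -> ->.
have jq := onth_lt jb.
have [ju|ju] := ltnP j (uphalf (size q)).
  by apply: (@DoubleRepUU _ _ _ _ _ t j a b x y); rewrite /u_vtx ?tq ?ju.
rewrite (_ : drop j q = drop (size q - (size q - j.+1).+1) q); last by congr drop; slia.
apply: (@DoubleRepUV _ _ _ _ _ t (size q - j.+1) a b x y) => //.
- by rewrite /u_vtx tq.
- by rewrite /v_vtx ifT; [rewrite (onth_rev jb)|slia].
- by slia.
Qed.

(** Common core of the operations and of breaking. The list [p] need not be a member of [P]: Add is
    the case [p = [::]], [S = P]. *)
Lemma cover_replace k P p S new :
  path_cover G k P -> perm_eq (flatten P) (p ++ flatten S) -> {subset S <= P} ->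
  all (is_path G) new -> all (fun s => k <= size s) new -> uniq (flatten new) ->
  (forall z, z \in flatten new -> z \in p \/ z \notin flatten P) ->
  path_cover G k (new ++ S).
Proof.
move=> [pP kP uP] PpS SP np nk nu nz; split.
- by move=> s; rewrite mem_cat => /orP[/(allP np)|/SP/pP].
- by move=> s; rewrite mem_cat => /orP[/(allP nk)|/SP/kP].
- rewrite flatten_cat cat_uniq nu /=.
  move: (uP); rewrite (perm_uniq PpS) cat_uniq => /and3P[_ pS ->]; rewrite andbT.
  apply/hasPn => z zS; apply/negP => /nz[zp|].
    by move/hasPn: pS => /(_ _ zS)/negP; apply.
  by rewrite (perm_mem PpS) mem_cat zS orbT.
Qed.

Definition bounded_cover k P := path_cover G k P /\ all (fun p => size p < 2 * k) P.

Lemma bounded_cover_nil k : bounded_cover k [::].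
Proof. by []. Qed.

Lemma perm_path_cover k P Q : perm_eq P Q -> path_cover G k P -> path_cover G k Q.
Proof.
move=> PQ [pP kP uP]; split=> [s|s|]; rewrite -?(perm_mem PQ); try by auto.
by rewrite -(perm_uniq (perm_flatten PQ)).
Qed.

Lemma card_covered k P : path_cover G k P -> #|covered P| = size (flatten P).
Proof. by case=> _ _ uP; rewrite cardsE; apply/card_uniqP. Qed.

(** The index [t] may lie in either half, so that this also yields the second path of DoubleRep. *)
Lemma rep_result P p r t v x : {in P, forall p, is_path G p} -> p \in P ->
  oriented p r -> onth r t = Some v -> extension G P v x -> is_path G (rev x ++ drop t r).
Proof.
move=> pP pinP pr tv /extensionP[px vx xP].
rewrite -is_path_rev rev_cat revK (onth_drop tv) rev_cons.
have dp : is_path G (rcons (rev (drop t.+1 r)) v).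
  by rewrite -rev_cons -(onth_drop tv) is_path_rev is_path_drop // (oriented_path pr) pP.
apply: is_path_join => //; apply/hasPn => z zx; apply/negP.
rewrite /= -rev_cons -(onth_drop tv) mem_rev => /mem_drop; rewrite (oriented_mem pr) => zp.
by move: (xP _ zx) => /negP; apply; apply/flattenP; exists p.
Qed.

Lemma perm_flatten_cons P p S : perm_eq P (p :: S) ->
  [/\ perm_eq (flatten P) (p ++ flatten S), {subset S <= P} & p \in P].
Proof.
move=> PS; split; first exact: (perm_flatten PS).
- by move=> s sS; rewrite (perm_mem PS) inE sS orbT.
- by rewrite (perm_mem PS) mem_head.
Qed.

(** Rep trades [t] vertices for at least [t.+1]. DoubleRep may discard the middle of a path, but
    leaves at least [2 * k] vertices where there were fewer. *)
Lemma operation_cover k P Q : 0 < k -> bounded_cover k P -> operation G k P Q ->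
  path_cover G k Q /\ size (flatten P) < size (flatten Q).
Proof.
case: k => // k _ [cP sP] opQ; have [pP kP uP] := cP.
case: opQ => [p pp pk pr|p q S q' PS pq /repP|p q S q1 q2 PS pq /double_repP].
- split; last by rewrite /= size_cat pk; slia.
  apply: (@cover_replace _ P [::] P [:: p]) => //=; rewrite ?pp ?pk ?leqnn ?cats0 //.
    by case/andP: pp.
  by move=> z /(allP pr); rewrite mem_covered; right.
- have [PpS SP pinP] := perm_flatten_cons PS.
  case=> r t v x qr rq' tv tr ex tx.
  have pr := oriented_trans pq qr.
  have [px vx xP] := extensionP ex.
  have szr := oriented_size pr.
  have np := rep_result pP pinP pr tv ex.
  have szq' : size q' = size x + (size p - t).
    by rewrite (oriented_size rq') size_cat size_rev size_drop szr.
  have q'p : is_path G q' by rewrite (oriented_path rq').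
  have kp : k < size p := kP _ pinP.
  split; last by rewrite (perm_size PpS) /= !size_cat szq'; clear -tr tx szr; slia.
  apply: (@cover_replace _ P p S [:: q']) => //=; rewrite ?q'p ?szq' ?cats0 //.
  + by clear -tr tx szr kp; slia.
  + by case/andP: q'p.
  + move=> z; rewrite (oriented_mem rq') mem_cat mem_rev => /orP[/xP|]; first by right.
    by move/mem_drop; rewrite (oriented_mem pr); left.
- have [PpS SP pinP] := perm_flatten_cons PS.
  case=> t j a b x y tq tj ta jb ex ey xy kx ky q1E q2E.
  have [px ax xP] := extensionP ex; have [py yb yP] := extensionP ey.
  have szq := oriented_size pq.
  have qp : is_path G q by rewrite (oriented_path pq) pP.
  have ltj := onth_lt jb.
  have inP z : z \in q -> z \in flatten P.
    by rewrite (oriented_mem pq) => zp; apply/flattenP; exists p.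
  have p2 : is_path G q2 by rewrite q2E; exact: (rep_result pP pinP pq jb ey).
  have p1 : is_path G q1.
    rewrite q1E (onth_take ta); apply: is_path_join => //.
      by rewrite -(onth_take ta) is_path_take.
    apply/hasPn => z /xP; apply: contra => /=; rewrite -(onth_take ta).
    by move/mem_take/inP.
  have s1 : size q1 = t.+1 + size x by rewrite q1E size_cat size_takel //; clear -tj ltj; slia.
  have s2 : size q2 = size q - j + size y by rewrite q2E size_cat size_rev size_drop addnC.
  have szp : size p < 2 * k.+1 := allP sP _ pinP.
  split; last by rewrite (perm_size PpS) /= !size_cat s1 s2; clear -szp szq kx ky; slia.
  apply: (@cover_replace _ P p S [:: q1; q2]) => //=; rewrite ?p1 ?p2 ?s1 ?s2 ?kx ?ky ?cats0 //.
    rewrite cat_uniq; case/andP: p1 => -> _; case/andP: p2 => -> _; rewrite andbT /=.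
    apply/hasPn => z; rewrite q1E q2E !mem_cat mem_rev => zq2; apply/negP => zq1.
    have [zy|zny] := boolP (z \in y).
      case/orP: zq1 => [/mem_take/inP|zx]; first by move/(negP (yP _ zy)).
      by move/hasPn: xy => /(_ _ zy)/negP; apply.
    move: zq2; rewrite (negPf zny) /= => zd.
    case/orP: zq1 => [zt|/xP/negP]; last by apply; apply/inP/(mem_drop zd).
    have : uniq (take j q ++ drop j q) by rewrite cat_take_drop; case/andP: qp.
    rewrite cat_uniq => /and3P[_ /hasPn/(_ _ zd)/negP + _]; apply.
    by rewrite /= -(cat_take_drop t.+1 (take j q)) take_takel // mem_cat zt.
  move=> z; rewrite mem_cat q1E q2E !mem_cat mem_rev.
  case/orP=> /orP[].
  + by move/mem_take; rewrite (oriented_mem pq); left.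
  + by move/xP; right.
  + by move/yP; right.
  + by move/mem_drop; rewrite (oriented_mem pq); left.
Qed.

Lemma break_cover k P Q : path_cover G k P -> break k P Q ->
  path_cover G k Q /\ size (flatten Q) = size (flatten P).
Proof.
move=> cP [a b S PS ab_size ab]; have [pP kP uP] := cP.
have [PpS SP pinP] := perm_flatten_cons PS.
split; last by rewrite (perm_size PpS) /= !size_cat addnA.
have abp := pP _ pinP; have [ap bp] := is_path_cat abp.
apply: (@cover_replace _ P (a ++ b) S [:: a; b]) => //=.
- by rewrite ap bp.
- by move: ab_size; rewrite size_cat; case: ab => -> ?; slia.
- by rewrite cats0; case/andP: abp.
- by move=> z; rewrite cats0; left.
Qed.

Lemma breaks_cover k P Q : path_cover G k P -> clos_refl_trans _ (@break T k) P Q ->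
  path_cover G k Q /\ size (flatten Q) = size (flatten P).
Proof.
move=> cP PQ; elim: PQ cP => {P Q} [P Q PQ cP|P cP|P Q R _ IH1 _ IH2 cP] //.
  exact: break_cover PQ.
by have [cQ <-] := IH1 cP; exact: IH2.
Qed.

Lemma round_bounded_cover k P Q : 0 < k -> bounded_cover k P -> round G k P Q ->
  bounded_cover k Q /\ #|covered P| < #|covered Q|.
Proof.
move=> k0 iP [P1 [P2 [op br sz P2Q]]].
have [c1 lt1] := operation_cover k0 iP op.
have [c2 s2] := breaks_cover c1 br.
have cQ := perm_path_cover P2Q c2.
split; first by split=> //; rewrite -(perm_all _ P2Q).
rewrite (card_covered iP.1) (card_covered cQ) -(perm_size (perm_flatten P2Q)) s2.
by [].
Qed.

(** Path numbers are therefore below the number of vertices and can be values of a search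
    variable. *)
Lemma size_bounded_cover k P : 0 < k -> path_cover G k P -> size P <= #|T|.
Proof.
move=> k0 cP; apply: leq_trans (max_card (mem (covered P))); rewrite (card_covered cP).
have [_ kP _] := cP; elim: P kP {cP} => //= p S IH kP; rewrite size_cat -add1n leq_add //.
  by apply: leq_trans k0 _; apply: kP; rewrite mem_head.
by apply: IH => q qS; apply: kP; rewrite inE qS orbT.
Qed.

Lemma execution_bounded_cover k tr P : 0 < k -> execution G k tr P -> bounded_cover k P.
Proof.
move=> k0; elim=> [|{}tr {}P Q _ iP PQ]; first exact: bounded_cover_nil.
by have [] := round_bounded_cover k0 iP PQ.
Qed.

(** Rep bounds extensions in the first half of an orientation; reversing the path gives the same
    bound from the other end. *)
Lemma ext_size_sym P p : 
  (forall q t v x, oriented p q -> t < uphalf (size q) -> onth q t = Some v ->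
     extension G P v x -> size x <= t) ->
  forall i v x, onth p i = Some v -> extension G P v x ->
    size x <= minn i (size p - i.+1).
Proof.
move=> H i v x iv ex; have ltp := onth_lt iv.
have [iu|ui] := ltnP i (uphalf (size p)).
  by have := H p i v x (or_introl erefl) iu iv ex; slia.
have := H (rev p) (size p - i.+1) v x (or_intror erefl).
by rewrite (onth_rev iv) size_rev => /(_ _ erefl ex); slia.
Qed.

(** * Collections to which no operation applies *)

Variable k : nat.
Variable P : coll T.
Hypothesis stuck : ~ exists Q, operation G k P Q.

Lemma stuck_ext p i v x : p \in P -> onth p i = Some v -> extension G P v x ->
  size x <= minn i (size p - i.+1).
Proof.
move=> pP; apply: ext_size_sym => q t w y pq tq tw ey.
rewrite leqNgt; apply/negP => ty; apply: stuck.
exists ((rev y ++ drop t q) :: rem p P).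
apply: OpRep (perm_to_rem pP) pq _.
by apply: (@RepU _ _ _ _ _ w); rewrite /u_vtx ?tq.
Qed.

Lemma stuck_double p i j a b x y : p \in P -> i < j ->
  onth p i = Some a -> onth p j = Some b ->
  extension G P a x -> extension G P b y -> ~~ has (mem x) y ->
  k <= i.+1 + size x -> k <= size p - j + size y -> False.
Proof.
move=> pP ij ia jb ea eb xy kx ky; apply: stuck.
have [iu|ui] := ltnP i (uphalf (size p)).
  eexists; apply: OpDoubleRep (perm_to_rem pP) (or_introl erefl) _.
  exact/double_repP/(@DoubleRepSpec _ _ _ _ _ i j a b x y).
(* Both indices lie in the second half: reversal exchanges their roles and brings [j] into the first
   half. *)
have ltj := onth_lt jb.
eexists; apply: OpDoubleRep (perm_to_rem pP) (or_intror erefl) _.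
apply/double_repP.
apply: (@DoubleRepSpec _ _ _ _ _ (size p - j.+1) (size p - i.+1) b a y x) => //.
- by rewrite size_rev; slia.
- by slia.
- exact: onth_rev.
- exact: onth_rev.
- by rewrite has_sym.
- by slia.
- by rewrite size_rev; slia.
Qed.

Lemma stuck_add x : is_path G x -> in_rest P x -> size x < k.
Proof.
move=> px rx; rewrite ltnNge; apply/negP => kx; apply: stuck.
exists (take k x :: P); apply: OpAdd; first exact: is_path_take.
- by rewrite size_takel.
- by apply/allP => z /mem_take; apply: (allP rx).
Qed.

End LocalSearch.

Lemma approx1_terminating k : 0 < k -> terminating k.
Proof.
move=> k0 T G [P [P0 step]].
have H i : bounded_cover G k (P i) /\ i <= #|covered (P i)|.
  elim: i => [|i [iP le]]; first by rewrite P0.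
  by have [? ?] := round_bounded_cover k0 iP (step i); split=> //; slia.
by have [_] := H #|T|.+1; rewrite leqNgt ltnS max_card.
Qed.

(** * Stretches of a path of the optimum *)

Section Stretches.
Variables (T : eqType) (a : pred T).
Implicit Types (s o : seq T).

Definition stretch s := take (find a s) s.

Definition load s := (1 + ~~ has a s) * size (stretch s).

Lemma stretch_cons x s : stretch (x :: s) = if a x then [::] else x :: stretch s.
Proof. by rewrite /stretch /=; case: (a x). Qed.

Lemma stretch_id s : ~~ has a s -> stretch s = s.
Proof. by move=> nas; rewrite /stretch hasNfind // take_size. Qed.

Lemma stretch_cat s1 s2 : has a s1 -> stretch (s1 ++ s2) = stretch s1.
Proof.
move=> as1; rewrite /stretch find_cat as1 take_cat; case: ltngtP => //.
  by move=> lt; move: (find_size a s1); lia.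
by move=> e; rewrite e subnn take0 cats0 take_size.
Qed.

Lemma stretch_mem z s : z \in stretch s -> ~~ a z.
Proof.
elim: s => [|x s IH] //; rewrite stretch_cons; case: ifP => // /negbT nax.
by rewrite inE => /orP[/eqP->|].
Qed.

Lemma stretch_lead x s z : z \in stretch s -> x \in s -> a x -> uniq s -> index z s < index x s.
Proof.
elim: s => [|y s IH] //; rewrite stretch_cons; case: ifP => // nay.
rewrite !inE => zs xs ax /andP[ys us] /=.
have yx : y != x by apply/eqP => e; rewrite e ax in nay.
rewrite (negPf yx); case: eqP => // /eqP yz.
move: zs xs; rewrite eq_sym (negPf yz) eq_sym (negPf yx) /= => zs xs.
by rewrite ltnS IH.
Qed.

Fixpoint loads s :=
  if s is x :: s' then (if a x then load s' else 0) + loads s' else 0.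

Lemma loads_none s : ~~ has a s -> loads s = 0.
Proof. by elim: s => //= x s IH; rewrite negb_or => /andP[/negPf-> /IH->]. Qed.

(* Every stretch lies between two selected elements, except for the first one and
   for the last one, and the latter is counted twice. *)
Lemma loads_count s : has a s ->
  loads s + size (stretch s) = count (predC a) s + size (stretch (rev s)).
Proof.
elim: s => // x s IH has_s; rewrite /= stretch_cons rev_cons -cats1.
have [as_|nas] := boolP (has a s).
  rewrite stretch_cat ?has_rev //; have := IH as_.
  rewrite /load as_; case: ifP => ax /=; lia.
move: has_s; rewrite /= (negPf nas) orbF => ax.
rewrite ax loads_none // /load nas /= stretch_id //.
have -> : stretch (rev s ++ [:: x]) = rev s.
  by rewrite /stretch find_cat has_rev (negPf nas) /= ax addn0 take_size_cat.
rewrite size_rev; have := count_predC a s.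
by move: nas; rewrite has_count -leqNgt leqn0 => /eqP->; lia.
Qed.

Lemma loads_sum s : uniq s ->
  loads s = \sum_(v <- s | a v) load (drop (index v s).+1 s).
Proof.
elim: s => [|x s IH]; first by rewrite big_nil.
move=> /= /andP[xs us]; rewrite big_cons eqxx /= drop0 IH //.
have -> : \sum_(v <- s | a v) load (drop (index v s).+1 s) =
    \sum_(j <- s | a j) load (drop (if x == j then 0 else (index j s).+1) s).
  rewrite big_seq_cond [RHS]big_seq_cond; apply: eq_bigr => v /andP[vs _].
  by rewrite ifN //; apply: contraNneq xs => ->.
by case: ifP.
Qed.

Definition side (b : bool) s := if b then s else rev s.

Lemma side_mem b s : side b s =i s.
Proof. by case: b => z; rewrite ?mem_rev. Qed.

Lemma side_uniq b s : uniq (side b s) = uniq s.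
Proof. by case: b; rewrite ?rev_uniq. Qed.

Lemma index_rev x s : uniq s -> x \in s -> index x (rev s) = size s - (index x s).+1.
Proof.
move=> us xs; have lt : index x s < size s by rewrite index_mem.
have {1}-> : x = nth x (rev s) (size s - (index x s).+1).
  by rewrite nth_rev ?subnSK ?subKn ?nth_index //; lia.
by rewrite index_uniq ?rev_uniq ?size_rev //; lia.
Qed.

Definition beyond (b : bool) v o := drop (index v (side b o)).+1 (side b o).

(** In each direction, [loads_count] is off by the difference between the first and the last
    stretch; adding the two directions cancels it. *)
Lemma double_count o : uniq o -> has a o ->
  2 * size o = \sum_(v <- o | a v) (2 + (load (beyond true v o) + load (beyond false v o))).
Proof.
move=> uo ao; rewrite big_split (big_split _ _ _ (fun v => load (beyond true v o))) /=.
have -> : \sum_(i <- o | a i) load (beyond true i o) = loads o by rewrite loads_sum.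
have -> : \sum_(i <- o | a i) load (beyond false i o) = loads (rev o).
  rewrite loads_sum ?rev_uniq //; apply: perm_big.
  by rewrite perm_sym perm_rev.
have := loads_count ao; have := @loads_count (rev o); rewrite has_rev => /(_ ao).
rewrite revK count_rev big_const_seq iter_addn_0 /=.
have := count_predC a o.
lia.
Qed.

Definition before (b : bool) v w o := index v (side b o) < index w (side b o).

Lemma before_neg b v w o : uniq o -> v \in o -> w \in o ->
  before (~~ b) v w o = before b w v o.
Proof.
move=> uo vo wo; case: b; rewrite /before /= !index_rev //;
  move: vo wo; rewrite -!index_mem; lia.
Qed.

Lemma mem_beyond b v z o : uniq o -> z \in o -> (z \in beyond b v o) = before b v z o.
Proof.
rewrite /beyond /before -(side_uniq b) -(side_mem b); move: (side b o) => s us zs.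
have := mem_cat z (take (index v s).+1 s) (drop (index v s).+1 s).
move: (us); rewrite -{1}(cat_take_drop (index v s).+1 s) cat_uniq => /and3P[_ /hasPn H _].
rewrite cat_take_drop zs in_take // ltnS; case: leqP => //= le.
  by move=> _; apply/negP => /H/negP; apply; rewrite /= in_take.
Qed.

Lemma index_beyond b v z o : z \in beyond b v o -> uniq o ->
  index z (side b o) = (index v (side b o)).+1 + index z (beyond b v o).
Proof.
rewrite /beyond -(side_uniq b); move: (side b o) => s zd.
rewrite -{1}(cat_take_drop (index v s).+1 s) cat_uniq => /and3P[_ /hasPn/(_ _ zd)/= nz _].
rewrite -{1}(cat_take_drop (index v s).+1 s) index_cat (negPf nz) size_takel //.
by rewrite ltnNge; apply/negP => le; move: zd; rewrite drop_oversize // ltnW.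
Qed.

Lemma stretch_beyond b v z o : uniq o -> z \in stretch (beyond b v o) ->
  [/\ z \in o, before b v z o &
      forall u, u \in o -> a u -> before b v u o -> before b z u o].
Proof.
move=> uo zr; have zn : z \in beyond b v o by apply: mem_take zr.
have zo : z \in o by rewrite -(side_mem b); apply: mem_drop zn.
split=> //; first by rewrite -mem_beyond.
move=> u uin au vu; have un : u \in beyond b v o by rewrite mem_beyond.
rewrite /before (index_beyond zn uo) (index_beyond un uo) ltn_add2l; apply: stretch_lead => //.
by apply: drop_uniq; rewrite side_uniq.
Qed.

(* Two selected elements meeting in a common stretch face each other through it. *)
Lemma stretch_share b c v w z o : uniq o -> v \in o -> w \in o -> a v -> a w -> v != w ->
  z \in stretch (beyond b v o) -> z \in stretch (beyond c w o) ->
  [/\ c = ~~ b, has a (beyond b v o) & has a (beyond c w o)].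
Proof.
move=> uo vo wo av aw vw zv zw.
have [zo vz Hv] := stretch_beyond uo zv; have [_ wz Hw] := stretch_beyond uo zw.
(* In a common direction, the later of [v] and [w] would end the stretch of the earlier one before
   [z]. *)
have [cb|/negPf cb] := eqVneq c b.
  subst c; exfalso.
  have : before b v w o \/ before b w v o.
    rewrite /before; case: ltngtP => //; try by [left|right].
    move=> e; move: vw; rewrite -(nth_index v (s := side b o) (x := v)) ?side_mem //.
    by rewrite e nth_index ?side_mem // eqxx.
  case=> [/(Hv _ wo aw)|/(Hw _ vo av)]; move: vz wz; rewrite /before; lia.
have {cb} cb : c = ~~ b by case: b c cb {vz Hv wz Hw zv zw} => [] [].
subst c; move: wz; rewrite before_neg // => zw'.
have bvw : before b v w o by move: vz zw'; rewrite /before; lia.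
split=> //; apply/hasP.
  by exists w => //; rewrite mem_beyond.
by exists v => //; rewrite mem_beyond // before_neg.
Qed.

Lemma beyond_size b v o : v \in o -> size (beyond b v o) = size o - (index v (side b o)).+1.
Proof. by move=> vo; rewrite size_drop; case: b; rewrite /= ?size_rev. Qed.

Lemma beyond_both v o : uniq o -> v \in o ->
  size (beyond true v o) + size (beyond false v o) + 1 = size o.
Proof.
move=> uo vo; rewrite !beyond_size //= index_rev //.
by move: vo; rewrite -index_mem; lia.
Qed.

End Stretches.

(** * The bound for one path of the output *)

Definition depth l i := minn i (l - i.+1).

(** An extension of order [k - 2 - d] just fails to complete the [d.+1] vertices from the nearer end
    to a path of order [k]. *)
Definition typical k d := minn d (k - 2 - d).

(** The largest depth on a path of order [l]. *)
Definition half_depth l := l.-1./2.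

(* Twice the number of optimal vertices charged to a path of order [l]: every
   position receives at most [3 * typical] halves, except for one, which may
   receive four times its depth. *)
Definition quota k l :=
  2 * l + \sum_(i < l) 3 * typical k (depth l i)
  + (4 * half_depth l - 3 * typical k (half_depth l)).

Section Quota.
Variables (k l : nat) (s : bool -> nat -> nat) (f : bool -> nat -> bool).
Hypotheses (k2 : 2 <= k) (kl : k <= l) (lk : l < 2 * k).

(** The stretch on side [b] is long enough for one half of DoubleRep, even with the nearer end of
    the path. *)
Let big b i := k <= depth l i + 1 + s b i.
Let charge i := (1 + f true i) * s true i + (1 + f false i) * s false i.

Hypothesis s_depth : forall b i, i < l -> s b i <= depth l i.
Hypothesis f_both : forall i, i < l -> f true i -> f false i ->
  k <= s true i + s false i + 1.
Hypothesis big_conflict : forall b c i j, i < l -> j < l -> i != j ->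
  big b i -> big c j -> [/\ c = ~~ b, ~~ f b i & ~~ f c j].

Let small i := ~~ big true i && ~~ big false i.

(** Two final sides would have total order at least [k - 1] by [f_both], but twice the minimum of
    [d] and [k - 2 - d] is at most [k - 2]. *)
Lemma charge_small i : i < l -> small i -> charge i <= 3 * typical k (depth l i).
Proof.
move=> il /andP[]; rewrite /big /charge /typical -!ltnNge.
have := s_depth true il; have := s_depth false il; have := f_both il.
by case: (f true i); case: (f false i) => /=; lia.
Qed.

Lemma charge_any i : i < l -> charge i <= 4 * depth l i.
Proof.
move=> il; have := s_depth true il; have := s_depth false il.
by rewrite /charge; case: (f true i); case: (f false i) => /=; lia.
Qed.

(** A shared stretch is not final and counts once; only the other side can count twice, and there
    the typical bound holds. *)
Lemma charge_shared b i : i < l -> ~~ big (~~ b) i -> ~~ f b i ->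
  charge i <= depth l i + 2 * typical k (depth l i).
Proof.
move=> il; rewrite /big /charge /typical -!ltnNge.
have := s_depth true il; have := s_depth false il.
by case: b; case: (f true i); case: (f false i) => /=; lia.
Qed.

Lemma depth_half i : i < l -> depth l i <= half_depth l.
Proof. by rewrite /depth /half_depth; lia. Qed.

Lemma big_exists i : ~~ small i -> exists b, big b i.
Proof. by rewrite negb_and !negbK => /orP[]; [exists true|exists false]. Qed.

(** Big vertices pairwise face opposite ways, so there are at most two of them. For a single one of
    depth [d], the excess [4 * d - 3 * typical k d] grows with [d], hence [half_depth]. Two of them
    exceed the typical bound by at most [d - typical k d] each, which is less in total. *)
Lemma charge_total : 2 * l + \sum_(i < l) charge i <= quota k l.
Proof.
rewrite /quota -addnA leq_add2l.
have le_rest (A : pred 'I_l) : (forall i, A i -> small i) ->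
    \sum_(i < l | A i) charge i <= \sum_(i < l | A i) 3 * typical k (depth l i).
  by move=> sA; apply: leq_sum => i Ai; apply: charge_small; rewrite ?ltn_ord ?sA.
have [/forallP all_small|] := boolP [forall i : 'I_l, small i].
  by apply: leq_trans (le_rest predT (fun i _ => all_small i)) (leq_addr _ _).
rewrite negb_forall => /existsP[i /big_exists[b bi]].
rewrite (bigD1 i) // [X in _ <= X + _](bigD1 i) //=.
have [/forallP rest_small|] := boolP [forall j : 'I_l, (j != i) ==> small j].
  apply: leq_trans (leq_add (charge_any (ltn_ord i)) (le_rest _ (fun j => implyP (rest_small j)))) _.
  have := depth_half (ltn_ord i); move: (\sum_(_ < _ | _) _) (depth l i) (half_depth l) => x d h.
  by rewrite /typical; lia.
rewrite negb_forall => /existsP[j]; rewrite negb_imply => /andP[ji /big_exists[c bj]].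
rewrite (bigD1 j) // [X in _ <= _ + X + _](bigD1 j) //=.
have ij : nat_of_ord i != j by rewrite eq_sym; apply: contra ji => /eqP/val_inj->.
have [cb nfi nfj] := big_conflict (ltn_ord i) (ltn_ord j) ij bi bj.
have nbi : ~~ big (~~ b) i.
  apply/negP => bi'; have [] := big_conflict (ltn_ord i) (ltn_ord j) ij bi' bj.
  by rewrite cb; case: (b).
have nbj : ~~ big (~~ c) j.
  apply/negP => bj'; have [] := big_conflict (ltn_ord i) (ltn_ord j) ij bi bj'.
  by rewrite cb; case: (b).
have small_rest (h : 'I_l) : (h != i) && (h != j) -> small h.
  move=> /andP[hi hj].
  have H d : ~~ big d h.
    apply/negP => bh.
    have hi' : nat_of_ord h != i by apply: contra hi => /eqP/val_inj->.
    have hj' : nat_of_ord h != j by apply: contra hj => /eqP/val_inj->.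
    have [bd _ _] := big_conflict (ltn_ord h) (ltn_ord i) hi' bh bi.
    have [cd _ _] := big_conflict (ltn_ord h) (ltn_ord j) hj' bh bj.
    by move: cb bd cd; case: (b); case: (c); case: (d).
  by rewrite /small !H.
apply: leq_trans (leq_add (charge_shared (ltn_ord i) nbi nfi)
  (leq_add (charge_shared (ltn_ord j) nbj nfj) (le_rest _ small_rest))) _.
have := depth_half (ltn_ord i); have := depth_half (ltn_ord j).
have : k - 2 <= 2 * half_depth l by rewrite /half_depth; lia.
move: (\sum_(_ < _ | _) _) (depth l i) (depth l j) (half_depth l) => x d e h.
by rewrite /typical; lia.
Qed.

End Quota.

Lemma sum_depth (F : nat -> nat) p b :
  \sum_(i < b + p.*2) F (depth (b + p.*2) i) =
  2 * (\sum_(i < p) F i) + (if b == 0 then 0 else \sum_(p <= i < b + p) F (depth (b + p.*2) i)).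
Proof.
rewrite -(big_mkord xpredT (fun i => F (depth (b + p.*2) i))).
rewrite (@big_cat_nat _ _ _ p) //=; last by lia.
rewrite [X in _ + X = _](@big_cat_nat _ _ _ (b + p)) //=; try by lia.
have -> : \sum_(0 <= i < p) F (depth (b + p.*2) i) = \sum_(i < p) F i.
  rewrite big_mkord; apply: eq_bigr => i _; congr F; rewrite /depth.
  by have := ltn_ord i; lia.
have -> : \sum_(b + p <= i < b + p.*2) F (depth (b + p.*2) i) = \sum_(i < p) F i.
  rewrite big_nat_rev /= -{1}[b + p]add0n big_addn.
  rewrite (_ : b + p.*2 - (b + p) = p); last by lia.
  rewrite big_mkord; apply: eq_bigr => i _; congr F; rewrite /depth.
  by have := ltn_ord i; lia.
case: b => [|b] /=; last by lia.
by rewrite add0n big_geq //; lia.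
Qed.

(** For [k = K.+2], [typical] rises with slope 1 up to about [k / 2] and then falls with slope 1.
    Past the summit the sum is thus quadratic in [p], and its value at [p = K.+2./2] fixes the
    constant term. *)
Lemma sum_typical K p : (K.+2)./2 <= p -> p <= K.+1 ->
  2 * (\sum_(i < p) typical K.+2 i) + p * p.-1 + 2 * (K.+2./2 * (K.+1 - K.+2./2)) <= 2 * K * p.
Proof.
have pS q : q.+1 * q = q * q.-1 + 2 * q by case: q => [|q] /=; lia.
elim: p => [|p IH] //.
rewrite leq_eqVlt => /orP[/eqP <- _|]; last first.
  rewrite ltnS => kp pk; have := IH kp (ltnW pk); rewrite big_ord_recr /=.
  rewrite pS (mulnS _ p) {3}/typical; set g := \sum_(i < p) _.
  have : minn p (K.+2 - 2 - p) <= K - p by lia.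
  clear -pk; nia.
have H q : 2 * (\sum_(i < q) typical K.+2 i) <= q * q.-1.
  elim: q => [|q IHq]; rewrite ?big_ord0 // big_ord_recr /= pS.
  have : typical K.+2 q <= q := geq_minl _ _.
  by move: (typical K.+2 q) (\sum_(i < q) _) IHq => t g; lia.
have := H K.+2./2; move: (\sum_(_ < _) _) => g.
have [m [b [-> b1]]] : exists m b : nat, K = m.*2 + b /\ b <= 1.
  by exists K./2, (odd K); lia.
rewrite (_ : (m.*2 + b).+2./2 = m.+1); last by lia.
rewrite (_ : (m.*2 + b).+1 - m.+1 = m + b); last by lia.
rewrite -muln2 /=; case: b b1 => [|[|]] // _; lia.
Qed.

(** Equality holds for all odd [l], whence the constants 1 and 7. The parity of [k] enters through
    the product of the two halves of [K.+1] in [sum_typical]. *)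
Lemma quota_bound k l : 2 <= k -> k <= l -> l < 2 * k ->
  4 * quota k l + 3 * l ^ 2 + 6 * k ^ 2 <= 4 * (3 * k + 1) * l + (if odd k then 1 else 7).
Proof.
case: k => [|[|K]] // _ kl lk.
rewrite /quota -big_distrr /=.
have [p [b [lE b1]]] : exists p b : nat, l = b + p.*2 /\ b <= 1.
  by exists l./2, (odd l); lia.
have kp : K.+2./2 <= p by lia.
have pk : p <= K.+1 by lia.
have := sum_typical kp pk.
have := sum_depth (typical K.+2) p b; rewrite -lE => ->.
have -> : (if b == 0 then 0 else \sum_(p <= i < b + p) typical K.+2 (depth l i)) = b * typical K.+2 p.
  case: b b1 lE => [|[|]] // _ lE; rewrite add1n big_nat1 mul1n; congr typical; rewrite /depth; lia.
have -> : half_depth l = p + b - 1 by rewrite /half_depth; lia.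
have -> : odd K = odd K.+2 by rewrite /= negbK.
move: (\sum_(_ < _) _) => g.
have [m [c [KE c1]]] : exists m c : nat, K = m.*2 + c /\ c <= 1.
  by exists K./2, (odd K); lia.
have -> : K.+2./2 = m.+1 by lia.
have -> : odd K.+2 = (c == 1) by lia.
have pm : m < p by lia.
rewrite (_ : K.+1 - m.+1 = m + c); last by lia.
rewrite /typical (_ : K.+2 - 2 - p = K - p); last by lia.
have -> : minn (p + b - 1) (K.+2 - 2 - (p + b - 1)) = K + 1 - p - b by lia.
case: p pm {kp} pk lE => // p pm pk lE; rewrite [_.+1.-1]/=.
(* [p] has been decreased by 1, and [n] is [K - p]. In terms of [n] and [e] the truncated
   subtractions only matter at [n = 0], and each parity case is a polynomial inequality. *)
have [n [e [ne mE]]] : exists n e : nat, p = m + e /\ n + e = m + c.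
  by exists (m + c - (p - m)), (p - m); lia.
have Kp : K - p.+1 = n.-1 by lia.
have Kb : K + 1 - p.+1 - b = n - b by lia.
have mnE : minn p.+1 n.-1 <= n.-1 by rewrite geq_minr.
have tE : 4 * (p.+1 + b - 1) - 3 * (n - b) + 3 * (n - b) = 4 * (p + b) by lia.
rewrite Kp Kb; move: (minn _ _) mnE (_ - 3 * (n - b)) tE => mn mnE t tE.
have {}KE : K = m + n + e by lia.
rewrite lE KE ne -muln2; rewrite ne in tE; move: mE tE mnE => {lE KE ne Kp Kb pm pk kl lk}.
case: c c1 => [|[|]] // _ mE; case: b b1 => [|[|]] // _ tE mnE gE.
- have mE' : m = n + e by lia.
  rewrite mE' in tE gE *; clear mE mE' mnE; lia.
- have mE' : m = n + e by lia.
  rewrite mE' in tE gE *; clear mE mE'; case: n tE mnE gE => [|n] /=; lia.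
- case: n mE tE mnE gE => [|n] mE tE _ gE.
    have eE : e = m.+1 by lia.
    rewrite eE in tE gE *; clear mE eE; lia.
  have mE' : m = n + e by lia.
  rewrite mE' in tE gE *; clear mE mE'; lia.
- case: n mE tE mnE gE => [|n] mE tE mnE gE.
    have eE : e = m.+1 by lia.
    rewrite eE in tE gE *; clear mE eE; move: tE mnE gE => /=; lia.
  have mE' : m = n + e by lia.
  rewrite mE' in tE gE *; clear mE mE'; move: tE mnE gE => /=; lia.
Qed.

(** * The approximation ratio *)

Section Ratio.
Variables (T : finType) (G : sgraph T) (k : nat) (P Q : coll T).
Hypotheses (k2 : 2 <= k) (invP : bounded_cover G k P).
Hypothesis stuck : ~ exists P', operation G k P P'.
Hypothesis coverQ : path_cover G k Q.

Let sel : pred T := mem (flatten P).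

(** For a vertex missed by [Q], [find] returns [size Q], and the default is the empty path, whose
    stretches are empty. *)
Let home v := nth [::] Q (find (fun o : seq T => v \in o) Q).

Let arm b v := stretch sel (beyond b v (home v)).

Lemma home_out v : v \notin flatten Q -> home v = [::].
Proof.
move=> vQ; rewrite /home nth_default // leqNgt -has_find; apply/hasPn => o oQ.
by apply: contra vQ => vo; apply/flattenP; exists o.
Qed.

Lemma home_in v : v \in flatten Q -> home v \in Q /\ v \in home v.
Proof.
move=> /flattenP[o oQ vo]; have hasv : has (fun o : seq T => v \in o) Q by apply/hasP; exists o.
by rewrite /home mem_nth -?has_find //; split=> //; apply: (nth_find [::] hasv).
Qed.

Lemma disjoint_members (S : coll T) o o' v : uniq (flatten S) -> o \in S -> o' \in S ->
  v \in o -> v \in o' -> o = o'.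
Proof.
elim: S => // q S IH; rewrite /= cat_uniq => /and3P[_ /hasPn qS uS].
have nin w : w \in S -> v \in w -> v \in q -> False.
  move=> wS vw vq; have /qS/negP[] : v \in flatten S by apply/flattenP; exists w.
  by [].
rewrite !inE => /predU1P[->|oS] /predU1P[->|oS'] vo vo' //.
- by case: (nin _ oS').
- by case: (nin _ oS).
- exact: IH.
Qed.

Lemma home_eq o v : o \in Q -> v \in o -> home v = o.
Proof.
move=> oQ vo; have [hQ vh] : home v \in Q /\ v \in home v.
  by apply: home_in; apply/flattenP; exists o.
by have [_ _ uQ] := coverQ; apply: (disjoint_members uQ hQ oQ vh vo).
Qed.

Lemma member_uniq o : o \in Q -> uniq o.
Proof. by move=> oQ; have [pQ _ _] := coverQ; case/andP: (pQ _ oQ). Qed.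

Lemma arm_extension b v : extension G P v (arm b v).
Proof.
have [vQ|vQ] := boolP (v \in flatten Q); last by rewrite /arm home_out //; case: b.
have [hQ vh] := home_in vQ.
have hp : is_path G (side b (home v)).
  by have [pQ _ _] := coverQ; case: b; rewrite /= ?is_path_rev pQ.
have dE : drop (index v (side b (home v))) (side b (home v)) = v :: beyond b v (home v).
  by rewrite drop_index // side_mem.
have := is_path_drop (index v (side b (home v))) hp.
rewrite dE => vp; apply/and3P; split.
- by apply: is_path_take; apply: is_path_drop.
- by apply/allP => z /stretch_mem; rewrite mem_covered.
- move/andP: vp => [_]; rewrite /= /arm /stretch.
  by rewrite -{1}(cat_take_drop (find sel (beyond b v (home v))) (beyond b v (home v))) cat_path => /andP[].
Qed.

(** The first conjunct prevents a vertex missed by [Q] from counting as final on both sides, which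
    would contradict [f_both]. *)
Let stop b v := (v \in flatten Q) && ~~ has sel (beyond b v (home v)).

Let charge v := (1 + stop true v) * size (arm true v) + (1 + stop false v) * size (arm false v).

Lemma load_charge v :
  load sel (beyond true v (home v)) + load sel (beyond false v (home v)) = charge v.
Proof.
rewrite /charge /stop; have [vQ|vQ] := boolP (v \in flatten Q) => //=.
by rewrite /arm home_out.
Qed.

Lemma optimum_charges : 2 * size (flatten Q) <= \sum_(v <- flatten P) (2 + charge v).
Proof.
have [[pP kP uP] _] := invP; have [pQ kQ uQ] := coverQ.
have -> : 2 * size (flatten Q) = \sum_(v <- flatten Q | sel v) (2 + charge v).
  rewrite size_flatten sumnE big_map big_distrr /= big_flatten /=.
  rewrite big_seq_cond [RHS]big_seq_cond; apply: eq_bigr => o /andP[oQ _].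
  rewrite (double_count (a := sel)) ?member_uniq //.
    rewrite big_seq_cond [RHS]big_seq_cond; apply: eq_bigr => v /andP[vo _].
    by rewrite -load_charge (home_eq oQ vo).
  (* A path of [Q] without vertices of [P] would permit Add. *)
  rewrite -[has _ _]negbK -all_predC; apply/negP => /allP op.
  have : size o < k.
    apply: (stuck_add stuck (pQ _ oQ)); apply/allP => z /op /=.
    by rewrite mem_covered.
  by rewrite ltnNge kQ.
have : \sum_(v <- flatten Q | sel v) (2 + charge v) =
    \sum_(v in [seq v <- flatten Q | sel v]) (2 + charge v).
  by rewrite -big_filter big_uniq //= filter_uniq.
move=> ->; rewrite big_uniq //= [X in X <= _]big_mkcond [X in _ <= X]big_mkcond /=.
apply: leq_sum => v _; rewrite mem_filter; case: ifP => // /andP[vP _].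
by rewrite ifT.
Qed.

Lemma member_quota p : p \in P -> \sum_(v <- p) (2 + charge v) <= quota k (size p).
Proof.
move=> pinP; have [[pP kP uP] sP] := invP; have [pQ kQ uQ] := coverQ.
have lk : size p < 2 * k := allP sP _ pinP.
have kl : k <= size p := kP _ pinP.
have up : uniq p by case/andP: (pP _ pinP).
case: p lk kl up pinP => [|v0 p'] lk kl up pinP; first by move: k2; rewrite leqNgt ltnS (leq_trans kl).
set p := v0 :: p' in lk kl up pinP *.
have onthp i : i < size p -> onth p i = Some (nth v0 p i).
  by move=> ip; have [w iw] := onth_lt_ex ip; rewrite iw (nth_onth v0 iw).
pose s b i := size (arm b (nth v0 p i)).
pose f b i := stop b (nth v0 p i).
rewrite (big_nth v0) big_mkord big_split /= sum_nat_const card_ord mulnC.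
apply: (charge_total (s := s) (f := f) k2 kl lk).
- move=> b i ip; exact: (stuck_ext stuck pinP (onthp _ ip) (arm_extension b _)).
- move=> i ip /andP[vQ n1] /andP[_ n2]; rewrite /s /arm !stretch_id //.
  have [hQ vh] := home_in vQ.
  by rewrite beyond_both ?member_uniq //; apply: kQ.
- move=> b c i j ip jp ij; rewrite /depth /s => bi bj.
  set v := nth v0 p i in bi *; set w := nth v0 p j in bj *.
  have vw : v != w by rewrite nth_uniq.
  have ev := arm_extension b v; have ew := arm_extension c w.
  have iv := onthp _ ip; have jw := onthp _ jp.
  have /hasP[z zw zv] : has (mem (arm b v)) (arm c w).
    apply/negPn/negP => ndisj; move: ij; rewrite neq_ltn => /orP[ij|ij].
      apply: (stuck_double stuck pinP ij iv jw ev ew ndisj).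
        by clear -bi ip; slia.
      by clear -bj jp; slia.
    apply: (stuck_double stuck pinP ij jw iv ew ev).
    + by rewrite has_sym.
    + by clear -bj jp; slia.
    + by clear -bi ip; slia.
  have inQ b' u y : y \in arm b' u -> u \in flatten Q.
    by apply: contraTT => nuQ; rewrite /arm home_out //; case: (b').
  have vQ := inQ _ _ _ zv; have wQ := inQ _ _ _ zw.
  have [hv vh] := home_in vQ; have [hw wh] := home_in wQ.
  (* The common vertex [z] lies on both optimal paths, and members of [Q] are disjoint or equal. *)
  have homeE : home w = home v.
    have sub b' u : u \in flatten Q -> z \in arm b' u -> z \in home u.
      by move=> uQ' /mem_take/mem_drop; rewrite side_mem.
    by apply: (disjoint_members uQ hw hv (sub _ _ wQ zw) (sub _ _ vQ zv)).
  have zw' : z \in stretch sel (beyond c w (home v)) by rewrite -homeE.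
  have selp u : u \in p -> sel u by move=> up'; apply/flattenP; exists p.
  have [cb h1 h2] : [/\ c = ~~ b, has sel (beyond b v (home v)) & has sel (beyond c w (home v))].
    apply: (stretch_share (member_uniq hv) vh _ _ _ vw zv zw'); first by rewrite -homeE.
    + exact/selp/mem_nth.
    + exact/selp/mem_nth.
  by split=> //; rewrite /f /stop -/v -/w ?homeE ?h1 ?h2 andbF.
Qed.

Lemma optimum_quota : 2 * size (flatten Q) <= \sum_(p <- P) quota k (size p).
Proof.
apply: leq_trans optimum_charges _; rewrite big_flatten /=.
rewrite big_seq_cond [X in _ <= X]big_seq_cond; apply: leq_sum => p /andP[pP _].
exact: member_quota.
Qed.

End Ratio.

(** * From quotas to ratios *)

Section RealRatio.
Import Order.TTheory GRing.Theory Num.Theory.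
Local Open Scope ring_scope.

Lemma quota_ratio (R : rcfType) k (r : R) : (2 <= k)%N -> 0 < r ->
  (forall l, (k <= l < 2 * k)%N -> (quota k l)%:R <= 2 * r * l%:R) ->
  approximation_ratio k r.
Proof.
move=> k2 r0 H T G P [tr [ex stuck]].
have invP := execution_bounded_cover (ltnW k2) ex.
have [cP sP] := invP; have [pP kP uP] := cP.
split=> // opt [[Q cQ <-] _].
rewrite (card_covered cP) (card_covered cQ) ler_pdivrMr //.
have := optimum_quota k2 invP stuck cQ; rewrite -(ler_nat R) natrM => le1.
rewrite -(@ler_pM2l _ 2) //; apply: le_trans le1 _.
rewrite size_flatten sumnE big_map !natr_sum big_distrl big_distrr /=.
rewrite big_seq_cond [X in _ <= X]big_seq_cond; apply: ler_sum => p /andP[pinP _].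
rewrite [_ * r]mulrC mulrA; apply: H.
by rewrite (kP _ pinP) (allP sP _ pinP).
Qed.

Lemma approx1_ratio (R : rcfType) k : (2 <= k)%N -> approximation_ratio k (rho R k).
Proof.
move=> k2.
(* Three times the constant of [quota_bound]. *)
pose d : R := if odd k then 3 else 21.
have k2R : 2 <= k%:R :> R by rewrite (ler_nat R 2 k).
have dle : d <= 21 by rewrite /d; case: odd => //; lra.
have d0 : 0 <= d by rewrite /d; case: odd => //; lra.
have X0 : 0 <= Num.sqrt (18 * k%:R ^+ 2 - d) by exact: sqrtr_ge0.
have XE : Num.sqrt (18 * k%:R ^+ 2 - d) ^+ 2 = 18 * k%:R ^+ 2 - d.
  by rewrite sqr_sqrtr //; nra.
have -> : rho R k = (3 * k%:R + 1) / 2 - 1 / 4 * Num.sqrt (18 * k%:R ^+ 2 - d).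
  by [].
move: (Num.sqrt _) X0 XE => X X0 XE.
apply: quota_ratio => //; first by nra.
move=> l /andP[kl lk]; have := quota_bound k2 kl lk.
move: (quota k l) => q; rewrite -(ler_nat R) => le.
have {le}le : 4 * q%:R + 3 * l%:R ^+ 2 + 6 * k%:R ^+ 2
    <= 4 * (3 * k%:R + 1) * l%:R + d / 3 :> R.
  have e1 : (4 * q + 3 * l ^ 2 + 6 * k ^ 2)%:R
      = 4 * q%:R + 3 * l%:R ^+ 2 + 6 * k%:R ^+ 2 :> R by rewrite 2!natrD !natrM; ring.
  have e2 : (4 * (3 * k + 1) * l + (if odd k then 1 else 7))%:R
      = 4 * (3 * k%:R + 1) * l%:R + d / 3 :> R.
    by rewrite natrD !natrM natrD natrM /d; case: odd; field.
  by rewrite -e1 -e2.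
(* This is AM-GM; the worst order would be [l = X / 3]. *)
have : 0 <= (3 * l%:R - X) ^+ 2 by exact: sqr_ge0.
nra.
Qed.

(** Direct evaluation of the four possible orders; order 5 is extremal, with quota 24. *)
Lemma approx1_ratio4 (R : rcfType) : approximation_ratio 4 (12 / 5 : R).
Proof.
apply: quota_ratio => //; first by lra.
move=> l l48; have : (5 * quota 4 l <= 24 * l)%N.
  have : l \in iota 4 4 by rewrite mem_iota.
  by rewrite !inE => /or4P[] /eqP ->; rewrite /quota !big_ord_recl big_ord0.
by rewrite -(ler_nat R) !natrM; lra.
Qed.

End RealRatio.

(** * A tight instance for k = 4 *)

Section Tight.

(* The output consists of two copies (c = 0 and c = 12) of a path
   u_0 u_1 u_2 v_1 v_0, made of the vertices c, ..., c + 4.  The optimum covers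
   everything by the paths (c+6) (c+5) u_2 (c+7) (c+8) and
   (c+9) u_1 (c+10) v_1 (c+11), and by one more 4-path, formed by the vertices
   u_0 and v_0 of both copies. *)
Definition tight_copy c : seq (nat * nat) :=
  [seq (c + xy.1, c + xy.2) | xy <-
    [:: (0, 1); (1, 2); (2, 3); (3, 4); (2, 5); (5, 6); (2, 7); (7, 8);
        (1, 9); (1, 10); (3, 10); (3, 11)]].

Definition tight_edges := tight_copy 0 ++ tight_copy 12 ++ [:: (0, 4); (4, 12); (12, 16)].

Definition tight_rel x y := ((x, y) \in tight_edges) || ((y, x) \in tight_edges).

Lemma tight_sym : symmetric (fun x y : 'I_24 => tight_rel x y).
Proof. by move=> x y; rewrite /tight_rel orbC. Qed.

Lemma tight_irrefl : irreflexive (fun x y : 'I_24 => tight_rel x y).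
Proof.
move=> x; apply/negbTE.
have : all (fun x => ~~ tight_rel x x) (iota 0 24) by vm_compute.
by move/allP; apply; rewrite mem_iota /=.
Qed.

Definition tight_graph := SGraph tight_sym tight_irrefl.

Local Notation "'V' i" := (@Ordinal 24 i isT) (at level 10, i at level 8).

Definition tight_path1 : seq 'I_24 := [:: V 0; V 1; V 2; V 3; V 4].
Definition tight_path2 : seq 'I_24 := [:: V 12; V 13; V 14; V 15; V 16].
Definition tight_output : coll 'I_24 := [:: tight_path2; tight_path1].

Definition tight_optimum : coll 'I_24 :=
  [:: [:: V 6; V 5; V 2; V 7; V 8]; [:: V 9; V 1; V 10; V 3; V 11];
      [:: V 18; V 17; V 14; V 19; V 20]; [:: V 21; V 13; V 22; V 15; V 23];
      [:: V 0; V 4; V 12; V 16]].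

Definition tight_rest := [seq x <- iota 0 24 | 5 <= x %% 12].

Opaque tight_rel.

Lemma mem_tight_rest (z : 'I_24) : z \notin flatten tight_output -> val z \in tight_rest.
Proof.
move=> zP; have : all (fun x => (x \in map val (flatten tight_output)) || (x \in tight_rest)) (iota 0 24).
  by vm_compute.
have zi : val z \in iota 0 24 by rewrite mem_iota ltn_ord.
move/allP => /(_ _ zi) /orP[] //.
by rewrite (mem_map val_inj) (negPf zP).
Qed.

Opaque tight_rest tight_output.

(** The uncovered vertices induce a matching and isolated vertices, so it is enough to inspect
    triples. *)
Lemma tight_rest_path (x : seq 'I_24) : is_path tight_graph x -> in_rest tight_output x -> size x <= 2.
Proof.
have H : all (fun a => all (fun b => all (fun c =>
    ~~ [&& tight_rel a b, tight_rel b c & a != c]) tight_rest) tight_rest) tight_rest.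
  by vm_compute.
rewrite in_restE; case: x => [|a [|b [|c x]]]; [by []|by []|by []|].
case/andP=> /andP[ax _] /and3P[ab bc _].
have ac : a != c by apply: contraNneq ax => ->; rewrite !inE eqxx orbT.
case/and4P=> /mem_tight_rest aP /mem_tight_rest bP /mem_tight_rest cP _.
move/allP: H => /(_ _ aP)/allP/(_ _ bP)/allP/(_ _ cP)/negP[].
by apply/and3P; split; [apply: ab|apply: bc|].
Qed.

(** For a covered vertex, [v %% 12] is its position in its copy. *)
Definition tight_depth v := minn (v %% 12) (4 - v %% 12).

Lemma tight_extension (v : 'I_24) x : v \in flatten tight_output ->
  extension tight_graph tight_output v x -> size x <= tight_depth v.
Proof.
move=> vP /and3P[px rx].
have sx := tight_rest_path px rx; move: rx; rewrite in_restE => rx.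
have H1 : all (fun v => (tight_depth v == 0) ==> all (fun a => ~~ tight_rel v a) tight_rest)
    (map val (flatten tight_output)) by vm_compute.
have H2 : all (fun v => (tight_depth v == 1) ==> all (fun a => all (fun b =>
    ~~ (tight_rel v a && tight_rel a b)) tight_rest) tight_rest)
    (map val (flatten tight_output)) by vm_compute.
have vP' : val v \in map val (flatten tight_output) by rewrite (mem_map val_inj).
move/allP: H1 => /(_ _ vP'); move/allP: H2 => /(_ _ vP').
case: (tight_depth _) => [|[|d]]; last by move=> _ _ _; apply: leq_trans sx _.
- case: x {px sx} rx => // a x /andP[/mem_tight_rest aP _] _ /allP/(_ _ aP)/negP na /andP[va _].
  by case: na; apply: va.
- case: x {px sx} rx => [|a [|b x]] // /and3P[/mem_tight_rest aP /mem_tight_rest bP _].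
  move=> /allP/(_ _ aP)/allP/(_ _ bP)/negP nab _ /and3P[va ab _].
  by case: nab; apply/andP; split; [apply: va|apply: ab].
Qed.

Transparent tight_output.

Lemma tight_position p q t v : p \in tight_output -> oriented p q -> onth q t = Some v ->
  [/\ size q = 5, v \in flatten tight_output & tight_depth v = minn t (4 - t)].
Proof.
move=> pP pq tv; split.
- by move: pP; rewrite (oriented_size pq) !inE => /orP[]/eqP->.
- by apply/flattenP; exists p => //; rewrite -(oriented_mem pq); apply: onth_mem tv.
move: pP tv; rewrite !inE; case: pq => -> /orP[]/eqP-> /=;
  by do 5 (case: t => [|t]; first by case=> <-); case: t.
Qed.

(** Extensions are bounded by the depth, which excludes Rep. In DoubleRep the first new path needs
    [t = 2], the middle; then [j >= 3], and the second one has order at most 3. *)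
Lemma tight_stuck : ~ exists Q, operation tight_graph 4 tight_output Q.
Proof.
case=> Q [p pp p4 /(tight_rest_path pp)|p q S q' pP pq /repP|p q S q1 q2 pP pq /double_repP].
- by rewrite p4.
- have [_ _ pin] := perm_flatten_cons pP.
  case=> r t v x qr _ tv tr ex tx.
  have [sr vP dv] := tight_position pin (oriented_trans pq qr) tv.
  by have := tight_extension vP ex; rewrite dv; clear -tx; lia.
- have [_ _ pin] := perm_flatten_cons pP.
  case=> t j a b x y tq tj ta jb ex ey _ kx ky _ _.
  have [sq aP da] := tight_position pin pq ta; have [_ bP db] := tight_position pin pq jb.
  have := tight_extension aP ex; have := tight_extension bP ey.
  move: tq kx ky; rewrite da db sq; clear -tj; lia.
Qed.

Transparent tight_rel.

Lemma tight_round_add (P : coll 'I_24) p :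
  is_path tight_graph p -> size p = 4 -> in_rest P p ->
  all (fun p => size p < 8) P -> round tight_graph 4 P (p :: P).
Proof.
move=> pp p4 rp sP; exists (p :: P), (p :: P); split=> //; first exact: OpAdd.
- exact: rt_refl.
- by rewrite /= p4.
Qed.

(** Rep at v_0 removes an empty suffix, that is, it appends a vertex; the bound 7 leaves nothing to
    break. *)
Lemma tight_round_rep (P : coll 'I_24) p v : 1 < size p -> size p < 7 ->
  extension tight_graph (p :: P) (last v p) [:: v] ->
  all (fun p => size p < 8) P -> round tight_graph 4 (p :: P) (rcons p v :: P).
Proof.
move=> p0 sp ev sP; exists (rcons p v :: P), (rcons p v :: P); split=> //.
- apply: OpRep (perm_refl _) (or_introl erefl) _.
  have -> : rcons p v = take (size p - 0) p ++ [:: v] by rewrite subn0 take_size cats1.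
  apply: (@RepV _ _ _ _ 0 (last v p)) => //; rewrite /v_vtx ifT; last by lia.
  by case/lastP: p p0 {sp ev} => // p w _; rewrite rev_rcons last_rcons.
- exact: rt_refl.
- by rewrite /= size_rcons; apply/andP; split.
Qed.

Lemma tight_returns : returns tight_graph 4 tight_output.
Proof.
eexists; split; last exact: tight_stuck.
have e0 := ExecStart tight_graph 4.
have r1 : round tight_graph 4 [::] [:: take 4 tight_path1].
  by apply: tight_round_add => //; rewrite in_restE.
have r2 : round tight_graph 4 [:: take 4 tight_path1] [:: tight_path1].
  apply: (@tight_round_rep [::] (take 4 tight_path1) (V 4)) => //.
  by rewrite /extension in_restE.
have r3 : round tight_graph 4 [:: tight_path1] [:: take 4 tight_path2; tight_path1].
  by apply: tight_round_add => //; rewrite in_restE.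
have r4 : round tight_graph 4 [:: take 4 tight_path2; tight_path1] tight_output.
  apply: (@tight_round_rep [:: tight_path1] (take 4 tight_path2) (V 16)) => //.
  by rewrite /extension in_restE.
exact: ExecRound (ExecRound (ExecRound (ExecRound e0 r1) r2) r3) r4.
Qed.

Lemma tight_is_opt : is_opt tight_graph 4 24.
Proof.
split; last by move=> P _; have := max_card (mem (covered P)); rewrite card_ord.
have cQ : path_cover tight_graph 4 tight_optimum.
  split=> //; first by apply/allP.
  by apply/allP.
by exists tight_optimum => //; rewrite (card_covered cQ).
Qed.

Import GRing.Theory Num.Theory.
Local Open Scope ring_scope.

Lemma ratio4_attained (R : rcfType) : ratio_attained 4 (12 / 5 : R).
Proof.
exists 'I_24, tight_graph, tight_output, 24%N; split=> //.
- exact: tight_returns.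
- exact: tight_is_opt.
- have [tr [ex _]] := tight_returns.
  have [cP _] := execution_bounded_cover (isT : (0 < 4)%N) ex.
  by rewrite (card_covered cP) /=; lra.
Qed.

End Tight.

(** * Execution of loop programs *)

(* Each loop is counted as making [n] iterations, as a [CFor] loop does. *)
Fixpoint time_bound n c :=
  match c with
  | CSkip => 1
  | CSet _ i e => (cost i + cost e).+1
  | CWrite e => (cost e).+1
  | CSeq c1 c2 => (time_bound n c1 + time_bound n c2).+1
  | CIf e c1 c2 => (cost e + (time_bound n c1 + time_bound n c2)).+1
  | CWhile e c1 => n * (cost e + time_bound n c1).+1 + (cost e).+1
  end.

Fixpoint loop_depth c :=
  match c with
  | CSkip | CSet _ _ _ | CWrite _ => 0
  | CSeq c1 c2 | CIf _ c1 c2 => maxn (loop_depth c1) (loop_depth c2)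
  | CWhile _ c1 => (loop_depth c1).+1
  end.

Fixpoint modifies c (a : nat) :=
  match c with
  | CSkip | CWrite _ => false
  | CSet b _ _ => a == b
  | CSeq c1 c2 | CIf _ c1 c2 => modifies c1 a || modifies c2 a
  | CWhile _ c1 => modifies c1 a
  end.

Lemma time_bound_poly c : exists C, forall n, time_bound n c <= C * n ^ loop_depth c + C.
Proof.
have le_pow C d e n : d <= e -> C * n ^ d + C <= 2 * C * n ^ e + 2 * C.
  (* The added 1 is for [n = 0], where [n ^ 0 = 1] but the higher powers vanish. *)
  move=> de; have : n ^ d <= n ^ e + 1.
    case: n => [|n]; last by rewrite (leq_trans (leq_pexp2l _ de)) // leq_addr.
    by case: d {de} => [|d]; rewrite ?expn0 ?leq_addl // exp0n.
  by move: (n ^ d) (n ^ e) => x y; nia.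
have sum_le C1 C2 c1 c2 x n : let d := maxn (loop_depth c1) (loop_depth c2) in
    time_bound n c1 <= C1 * n ^ loop_depth c1 + C1 ->
    time_bound n c2 <= C2 * n ^ loop_depth c2 + C2 ->
    (x + (time_bound n c1 + time_bound n c2)).+1 <=
      (2 * (C1 + C2) + x.+1) * n ^ d + (2 * (C1 + C2) + x.+1).
  move=> d /leq_trans/(_ (le_pow _ _ _ _ (leq_maxl _ (loop_depth c2)))) H1.
  move=> /leq_trans/(_ (le_pow _ _ _ _ (leq_maxr (loop_depth c1) _))) H2.
  by move: H1 H2; rewrite -/d; move: (n ^ d) => y; nia.
elim: c => [|a i e|e|c1 [C1 H1] c2 [C2 H2]|e c1 [C1 H1] c2 [C2 H2]|e c1 [C1 H1]] /=.
- by exists 1 => n; rewrite leq_addl.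
- by exists (cost i + cost e).+1 => n; rewrite leq_addl.
- by exists (cost e).+1 => n; rewrite leq_addl.
- by exists (2 * (C1 + C2) + 1) => n; have := sum_le C1 C2 c1 c2 0 n (H1 n) (H2 n); rewrite add0n.
- by exists (2 * (C1 + C2) + (cost e).+1) => n; exact: sum_le.
- exists (2 * C1 + cost e + 1) => n; have := H1 n; rewrite expnS.
  have : n <= n * n ^ loop_depth c1.
    by case: n => // n; rewrite -{1}[n.+1]muln1 leq_mul // expn_gt0.
  move: (time_bound n c1) => b; have [->|n0] := posnP n; first by nia.
  move: (n ^ _) => y; nia.
Qed.

Definition sc a := EGet a (ECst 0).

(** Conjunction: as [b] has value 0 or 1, the truth value of [a = 0] is less than [b] exactly when
    [a] is nonzero and [b] is 1. *)
Definition guard_all := foldr (fun a b => ELt (EEq a (ECst 0)) b) (ECst 1).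

Definition seqc := foldr CSeq CSkip.

Definition CFor a c :=
  CSeq (CSet a (ECst 0) (ECst 0))
    (CWhile (ELt (sc a) EOrder) (CSeq c (CSet a (ECst 0) (ESucc (sc a))))).

Lemma modifies_seqc (A : Type) (f : A -> cmd) l a :
  (forall x, ~~ modifies (f x) a) -> ~~ modifies (seqc (map f l)) a.
Proof. by move=> Hf; elim: l => //= x l IH; rewrite negb_or Hf. Qed.

Lemma loop_depth_seqc (A : Type) (f : A -> cmd) l :
  (forall x, loop_depth (f x) = 0) -> loop_depth (seqc (map f l)) = 0.
Proof. by move=> Hf; elim: l => //= x l ->; rewrite Hf. Qed.

Section Exec.
Variables (n : nat) (G : sgraph 'I_n).
Implicit Types (M : memory) (o : seq nat) (s : memory * seq nat) (Q : memory * seq nat -> Prop).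

(** Total correctness in Hoare style. The time bound depends on the syntax and [n] only, so it
    composes along the rules below. *)
Definition exec c s Q := exists t s', [/\ run G c s t s', t <= time_bound n c & Q s'].

Lemma eval_guard_all M l : eval G M (guard_all l) = all (fun e => eval G M e != 0) l :> nat.
Proof. by elim: l => //= e l ->; case: (eval G M e); case: all. Qed.

Lemma exec_weaken c s Q Q' : exec c s Q -> (forall s', Q s' -> Q' s') -> exec c s Q'.
Proof. by move=> [t [s' [r le q]]] H; exists t, s'; split=> //; apply: H. Qed.

Lemma exec_skip s Q : Q s -> exec CSkip s Q.
Proof. by move=> q; exists 1, s; split=> //; apply: RunSkip. Qed.

Lemma exec_set M o a i e Q :
  Q (update M a (eval G M i) (eval G M e), o) -> exec (CSet a i e) (M, o) Q.
Proof. by move=> q; eexists; eexists; split; [apply: RunSet| |exact: q]. Qed.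

Lemma exec_write M o e Q : Q (M, rcons o (eval G M e)) -> exec (CWrite e) (M, o) Q.
Proof. by move=> q; eexists; eexists; split; [apply: RunWrite| |exact: q]. Qed.

Lemma exec_seq c1 c2 s Q :
  exec c1 s (fun s' => exec c2 s' Q) -> exec (CSeq c1 c2) s Q.
Proof.
move=> [t1 [s1 [r1 le1 [t2 [s2 [r2 le2 q]]]]]].
exists (t1 + t2).+1, s2; split=> //; first exact: RunSeq r1 r2.
by rewrite /= ltnS leq_add.
Qed.

Lemma exec_if e c1 c2 s Q : (eval G s.1 e != 0 -> exec c1 s Q) ->
  (eval G s.1 e = 0 -> exec c2 s Q) -> exec (CIf e c1 c2) s Q.
Proof.
move=> H1 H2; have [e0|e0] := eqVneq (eval G s.1 e) 0.
  have [t [s' [r le q]]] := H2 e0; exists (cost e + t).+1, s'; split=> //.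
    exact: RunIfFalse.
  by rewrite /= ltnS leq_add2l (leq_trans le) // leq_addl.
have [t [s' [r le q]]] := H1 e0; exists (cost e + t).+1, s'; split=> //.
  exact: RunIfTrue.
by rewrite /= ltnS leq_add2l (leq_trans le) // leq_addr.
Qed.

Lemma updateE M a i x b j : update M a i x b j = if (b == a) && (j == i) then x else M b j.
Proof. by []. Qed.

Lemma update_same M a i x : update M a i x a i = x.
Proof. by rewrite /update !eqxx. Qed.

Lemma update_other M a i x b j : b != a -> update M a i x b j = M b j.
Proof. by move=> /negPf ba; rewrite /update ba. Qed.

Lemma run_frame c s t s' a j : run G c s t s' -> ~~ modifies c a -> s'.1 a j = s.1 a j.
Proof.
elim=> {c s t s'} //=.
- by move=> M o b i e ab; rewrite update_other.
- by move=> c1 c2 s1 s2 s3 t1 t2 _ IH1 _ IH2; rewrite negb_or => /andP[n1 n2]; rewrite IH2 ?IH1.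
- by move=> e c1 c2 s s' t _ _ IH; rewrite negb_or => /andP[n1 n2]; rewrite IH.
- by move=> e c1 c2 s s' t _ _ IH; rewrite negb_or => /andP[n1 n2]; rewrite IH.
- by move=> e c s1 s2 s3 t1 t2 _ _ IH1 _ IH2 n1; rewrite IH2 ?IH1.
Qed.

Lemma exec_frame c s Q : exec c s Q ->
  exec c s (fun s' => Q s' /\ forall a, ~~ modifies c a -> s'.1 a =1 s.1 a).
Proof.
move=> [t [s' [r le q]]]; exists t, s'; split=> //; split=> // a na j.
exact: run_frame r na.
Qed.

(** The counter is incremented after [c], so [c] has to establish the invariant for the memory with
    the counter already advanced. *)
Lemma exec_for (Inv : nat -> memory * seq nat -> Prop) a c M o :
  ~~ modifies c a ->
  Inv 0 (update M a 0 0, o) ->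
  (forall i s, i < n -> s.1 a 0 = i -> Inv i s ->
     exec c s (fun s' => Inv i.+1 (update s'.1 a 0 i.+1, s'.2))) ->
  exec (CFor a c) (M, o) (Inv n).
Proof.
move=> nmod Inv0 step; apply: exec_seq; apply: exec_set => /=.
set body := CSeq c _; set guard := ELt _ _.
have loop m i s : m + i = n -> s.1 a 0 = i -> Inv i s ->
    exists t s', [/\ run G (CWhile guard body) s t s',
      t <= m * (cost guard + time_bound n body).+1 + (cost guard).+1 & Inv n s'].
  elim: m i s => [|m IH] i s mi si Ii.
    exists (cost guard).+1, s; split=> //; last by rewrite -mi add0n.
    by apply: RunWhileFalse; rewrite /= si -mi add0n ltnn.
  have lt_in : i < n by rewrite -mi; lia.
  have [t1 [s1 [r1 le1 [I1 fr]]]] := exec_frame (step i s lt_in si Ii).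
  have s1i : s1.1 a 0 = i by rewrite fr.
  have [||t2 [s2 [r2 le2 I2]]] := IH i.+1 (update s1.1 a 0 i.+1, s1.2) _ _ I1.
  - by rewrite -mi; lia.
  - by rewrite /= update_same.
  (* 5 is the cost of incrementing the counter. *)
  have rb : run G body s (t1 + 5).+1 (update s1.1 a 0 i.+1, s1.2).
    apply: RunSeq r1 _; have := RunSet G s1.1 s1.2 a (ECst 0) (ESucc (sc a)).
    by rewrite -surjective_pairing /= s1i.
  exists (cost guard + (t1 + 5).+1 + t2).+1, s2; split=> //.
    by apply: RunWhileTrue rb r2; rewrite /= si lt_in.
  by move: le1 le2; rewrite [time_bound n body]/=; move: (cost guard) (time_bound n c) => x y; nia.
have [|t [s' [r le I]]] := loop n 0 (update M a 0 0, o) (addn0 n) _ Inv0; first by rewrite /= update_same.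
by exists t, s'; split.
Qed.

Lemma exec_seqc (A : Type) (x0 : A) (f : A -> cmd) (Inv : nat -> memory * seq nat -> Prop) l s :
  Inv 0 s ->
  (forall i s, i < size l -> Inv i s -> exec (f (nth x0 l i)) s (Inv i.+1)) ->
  exec (seqc (map f l)) s (Inv (size l)).
Proof.
elim: l Inv s => [|x l IH] Inv s I0 step /=; first exact: exec_skip.
apply: exec_seq; apply: exec_weaken (step 0 s _ I0) _ => // s1 I1.
by apply: (IH (fun i => Inv i.+1)) => // i s' il; apply: (step i.+1).
Qed.

Lemma exec_iota (f : nat -> cmd) (Inv : nat -> memory * seq nat -> Prop) m s :
  Inv 0 s -> (forall i s, i < m -> Inv i s -> exec (f i) s (Inv i.+1)) ->
  exec (seqc [seq f i | i <- iota 0 m]) s (Inv m).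
Proof.
move=> I0 step; have := @exec_seqc nat 0 f Inv (iota 0 m) s I0; rewrite size_iota; apply.
by move=> i s' im; rewrite nth_iota //; apply: step.
Qed.

End Exec.

(** * Shapes of operations *)

(* A mode (l, e, checks, news) describes one shape of operation: it applies to a
   path of order [l] ([l = 0] for Add) and [e] uncovered vertices, numbered
   consecutively, and replaces the path by [news], provided that consecutive
   vertices of every member of [checks] are adjacent. *)
Definition mode := (nat * nat * seq (seq nat) * seq (seq nat))%type.

Definition old_len (md : mode) := md.1.1.1.
Definition ext_len (md : mode) := md.1.1.2.
Definition checks (md : mode) := md.1.2.
Definition news (md : mode) := md.2.

(** A Rep mode lengthens a path by one vertex, hence to order at most [2 * k], and a single cut into
    two [k]-paths suffices. *)
Definition halve k (T : Type) (s : seq T) :=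
  if size s < 2 * k then [:: s] else [:: take k s; drop k s].

Definition add_mode k : mode := (0, k, [:: iota 0 k], [:: iota 0 k]).

Definition rep_path l b t := rev (iota l t.+1) ++ drop t (side b (iota 0 l)).

Definition rep_mode k l b t : mode :=
  (l, t.+1, [:: rep_path l b t], halve k (rep_path l b t)).

Definition double_paths k l b t j :=
  [:: take t.+1 (side b (iota 0 l)) ++ iota l (k - t.+1);
      rev (iota (l + (k - t.+1)) (k - (l - j))) ++ drop j (side b (iota 0 l))].

Definition double_mode k l b t j : mode :=
  (l, (k - t.+1) + (k - (l - j)), double_paths k l b t j, double_paths k l b t j).

(** For [t >= k.-1] the extension would contain a [k]-path, a case for Add. *)
Definition rep_modes k := flatten
  [seq flatten [seq [seq rep_mode k l b t | t <- iota 0 (minn k.-1 (uphalf l))]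
    | b <- [:: true; false]] | l <- iota k k].

Definition double_modes k := flatten
  [seq flatten [seq flatten [seq
    [seq double_mode k l b t j | j <- iota t.+1 (l - t.+1) & (k - t.+1) + (k - (l - j)) < k]
    | t <- iota 0 (uphalf l)] | b <- [:: true; false]] | l <- iota k k].

Definition modes k := add_mode k :: rep_modes k ++ double_modes k.

Lemma rep_modesP k md : reflect
  (exists l b t, [/\ md = rep_mode k l b t, k <= l < 2 * k, t < k.-1 & t < uphalf l])
  (md \in rep_modes k).
Proof.
apply: (iffP flatten_mapP) => [[l lk /flatten_mapP[b _ /mapP[t tk ->]]]|[l [b [t [-> lk tk tl]]]]].
  exists l, b, t; move: lk tk; rewrite !mem_iota leq_min mul2n addnn /= => lk /andP[tk tl].
  by split.
exists l; first by rewrite mem_iota addnn -mul2n.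
apply/flatten_mapP; exists b; first by case: b.
by apply: map_f; rewrite mem_iota leq_min tk tl.
Qed.

Lemma double_modesP k md : reflect
  (exists l b t j, [/\ md = double_mode k l b t j, k <= l < 2 * k, t < uphalf l, t < j < l
    & (k - t.+1) + (k - (l - j)) < k])
  (md \in double_modes k).
Proof.
apply: (iffP flatten_mapP).
  move=> [l lk /flatten_mapP[b _ /flatten_mapP[t tl /mapP[j]]]].
  rewrite mem_filter => /andP[sk jl ->]; exists l, b, t, j.
  move: lk tl jl; rewrite !mem_iota mul2n addnn /= => lk tl jl.
  by split=> //; move: jl tl; lia.
move=> [l [b [t [j [-> lk tl jl sk]]]]].
exists l; first by rewrite mem_iota addnn -mul2n.
apply/flatten_mapP; exists b; first by case: b.
apply/flatten_mapP; exists t; first by rewrite mem_iota.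
apply: map_f; rewrite mem_filter sk mem_iota; move: jl; lia.
Qed.

Lemma modesP k (A : mode -> Prop) : A (add_mode k) ->
  (forall l b t, k <= l < 2 * k -> t < k.-1 -> t < uphalf l -> A (rep_mode k l b t)) ->
  (forall l b t j, k <= l < 2 * k -> t < uphalf l -> t < j < l ->
     (k - t.+1) + (k - (l - j)) < k -> A (double_mode k l b t j)) ->
  forall md, md \in modes k -> A md.
Proof.
move=> H1 H2 H3 md; rewrite inE mem_cat => /or3P[/eqP->|/rep_modesP|/double_modesP] //.
  by move=> [l [b [t [-> *]]]]; apply: H2.
by move=> [l [b [t [j [-> *]]]]]; apply: H3.
Qed.

Lemma halve_map k (T T' : Type) (f : T -> T') s : [seq map f x | x <- halve k s] = halve k (map f s).
Proof. by rewrite /halve size_map; case: ifP => _ //=; rewrite map_take map_drop. Qed.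

Lemma mem_halve k (T : eqType) (s : seq T) : flatten (halve k s) =i s.
Proof. by move=> x; rewrite /halve; case: ifP => _ /=; rewrite cats0 ?cat_take_drop. Qed.

(** The third clause keeps the extension vertices apart from search variable [k.-1], which numbers
    the path except in Add. *)
Lemma mode_wf k md : 0 < k -> md \in modes k ->
  [/\ all (fun i => i < old_len md + ext_len md) (flatten (checks md)),
      all (fun i => i < old_len md + ext_len md) (flatten (news md)),
      (old_len md == 0) || (ext_len md < k), ext_len md <= k & news md != [::]].
Proof.
move=> k0; move: md; apply: modesP => [|l b t lk tk tl|l b t j lk tl jl sk];
  rewrite /old_len /ext_len /checks /news /=.
- have H : all (fun i => i < 0 + k) (iota 0 k) by apply/allP => i; rewrite mem_iota.
  by rewrite cats0 H leqnn.
- have H : all (fun i => i < l + t.+1) (rep_path l b t).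
    apply/allP => i; rewrite mem_cat mem_rev mem_iota => /orP[/andP[]//|/mem_drop].
    by rewrite side_mem mem_iota; lia.
  rewrite cats0 H (eq_all_r (mem_halve k _)) H; split=> //; first by apply/orP; right; lia.
    by lia.
  by rewrite /halve; case: ifP.
- set c1 := k - t.+1; set c2 := k - (l - j).
  have H : all (fun i => i < l + (c1 + c2)) (flatten (double_paths k l b t j)).
    apply/allP => i; rewrite /= cats0 !mem_cat mem_rev !mem_iota -/c1 -/c2.
    move=> /orP[/orP[/mem_take|]|/orP[|/mem_drop]]; rewrite ?side_mem ?mem_iota; lia.
  by rewrite H sk orbT ltnW.
Qed.

(** * Soundness and completeness of the modes *)

Section Modes.
Variables (T : finType) (G : sgraph T) (k : nat) (x0 : T).
Hypothesis k0 : 0 < k.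
Implicit Types (P : coll T) (xs q : seq T) (md : mode).

Definition old_path P i md := if old_len md == 0 then [::] else nth [::] P i.

Definition instance P xs i md (ss : seq (seq nat)) :=
  [seq [seq nth x0 (old_path P i md ++ xs) a | a <- s] | s <- ss].

Definition mode_ok P xs i md :=
  [&& (old_len md == 0) || (i < size P) && (size (nth [::] P i) == old_len md),
      all (fun v => v \notin flatten P) xs, uniq xs
    & all (sorted (adj G)) (instance P xs i md (checks md))].

(** The listing order is fixed as the program produces it: the first new path takes the row of the
    old one, the others are appended. *)
Definition mode_result P xs i md :=
  let new := instance P xs i md (news md) in
  if old_len md == 0 then P ++ new
  else set_nth [::] P i (head [::] new) ++ behead new.

Lemma map_nth_old q xs : [seq nth x0 (q ++ xs) a | a <- iota 0 (size q)] = q.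
Proof.
by apply: (@eq_from_nth _ x0); rewrite size_map size_iota // => i iq;
  rewrite (nth_map 0) ?size_iota // nth_iota // nth_cat iq.
Qed.

Lemma map_nth_ext q xs m c : m + c <= size xs ->
  [seq nth x0 (q ++ xs) a | a <- iota (size q + m) c] = take c (drop m xs).
Proof.
move=> mc; apply: (@eq_from_nth _ x0); first by rewrite size_map size_iota size_takel // size_drop; lia.
move=> i; rewrite size_map size_iota => ic.
rewrite (nth_map 0) ?size_iota // nth_iota // nth_cat -addnA ltnNge leq_addr /= addKn.
by rewrite nth_take // nth_drop.
Qed.

Lemma map_side (f : nat -> T) b s : map f (side b s) = side b (map f s).
Proof. by case: b; rewrite /= ?map_rev. Qed.

Lemma oriented_side b q : oriented q (side b q).
Proof. by case: b; [left|right]. Qed.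

Lemma orientedP p q : oriented p q -> exists b, q = side b p.
Proof. by case=> ->; [exists true|exists false]. Qed.

Lemma rep_instance b t q xs : t < size q -> size xs = t.+1 ->
  [seq nth x0 (q ++ xs) a | a <- rep_path (size q) b t] = rev xs ++ drop t (side b q).
Proof.
move=> tq sx; rewrite map_cat map_rev map_drop map_side map_nth_old.
by rewrite -{1}[size q]addn0 map_nth_ext ?add0n ?sx // drop0 take_oversize // sx.
Qed.

Lemma double_instance b t j q x y : size x = k - t.+1 -> size y = k - (size q - j) ->
  [seq [seq nth x0 (q ++ (x ++ y)) a | a <- s] | s <- double_paths k (size q) b t j]
  = [:: take t.+1 (side b q) ++ x; rev y ++ drop j (side b q)].
Proof.
move=> sx sy; rewrite /double_paths /= !map_cat map_rev map_take map_drop map_side map_nth_old.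
rewrite -{1}[size q]addn0 -sx map_nth_ext; last by rewrite size_cat; lia.
rewrite drop0 take_size_cat // map_nth_ext; last by rewrite size_cat; lia.
by rewrite drop_size_cat // -sy take_size.
Qed.

Lemma add_instance x : size x = k -> [seq nth x0 x a | a <- iota 0 k] = x.
Proof. by move=> <-; have := map_nth_old x [::]; rewrite cats0. Qed.

Lemma sorted_path s v x : sorted (adj G) (s ++ v :: x) -> path (adj G) v x.
Proof. by move/cat_sorted2 => []. Qed.

Lemma path_is_path v x : path (adj G) v x -> uniq x -> is_path G x.
Proof. by move=> vx ux; rewrite /is_path ux; case: x vx {ux} => //= a x /andP[]. Qed.

Lemma extension_ok P v x : path (adj G) v x -> uniq x ->
  all (fun z => z \notin flatten P) x -> extension G P v x.
Proof. by move=> vx ux xP; rewrite /extension (path_is_path vx ux) in_restE xP. Qed.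

Lemma set_nth_old P i l : i < size P -> size (nth [::] P i) = l ->
  exists p S, [/\ perm_eq P (p :: S), p = nth [::] P i, size p = l,
    forall q, perm_eq (set_nth [::] P i q) (q :: S)
    & all (fun p => size p < 2 * k) P -> all (fun p => size p < 2 * k) S].
Proof.
move=> iP sl; exists (nth [::] P i), (take i P ++ drop i.+1 P).
have PS : perm_eq P (nth [::] P i :: (take i P ++ drop i.+1 P)).
  by rewrite -{1}(cat_take_drop i P) (drop_nth [::]) // -cat1s perm_catCA cat1s.
split=> // [q'|]; first by rewrite set_nthE iP -cat1s perm_catCA cat1s.
by rewrite (perm_all _ PS) => /andP[].
Qed.

Lemma perm_set_two P S p q : perm_eq P (p :: S) -> perm_eq [:: p, q & S] (P ++ [:: q]).
Proof.
move=> PS; rewrite perm_sym cats1 perm_rcons perm_sym.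
by rewrite -(cat1s p) -(cat1s q) perm_catCA /= perm_cons perm_sym.
Qed.

Lemma sorted_rev_path v x s : sorted (adj G) (rev x ++ v :: s) -> path (adj G) v x.
Proof.
move=> h; apply: (@sorted_path (rev s)).
rewrite -cat_rcons -rev_cons -[x]revK -rev_cat rev_sorted.
by rewrite (eq_sorted (e' := adj G)) // => a b; rewrite adj_sym.
Qed.

Lemma mode_sound P xs i md : bounded_cover G k P -> md \in modes k ->
  size xs = ext_len md -> mode_ok P xs i md -> round G k P (mode_result P xs i md).
Proof.
move=> bP; have [[pP kP uP] sP] := bP; move: md; apply: modesP => [|l b t lk tk tl|l b t j lk tl jl sk];
  rewrite /ext_len /mode_ok /mode_result /instance /old_path /old_len /checks /news /=.
- move=> sx; rewrite add_instance // andbT => /and3P[xP ux ax].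
  exists (xs :: P), (xs :: P); split.
  + by apply: OpAdd; rewrite ?in_restE // /is_path ux.
  + exact: rt_refl.
  + by rewrite /= sP andbT sx; move: k0; clear; lia.
  + by rewrite -cat1s perm_catC.
- have l0 : (l == 0) = false by move: lk k0; clear; lia.
  rewrite l0 /= => sx /and4P[/andP[iP /eqP sl] xP ux]; rewrite andbT -sl.
  have [p [S [PS <- sp set_p sS]]] := set_nth_old iP sl.
  have [_ _ pin] := perm_flatten_cons PS.
  have tp : t < size p by rewrite sp; move: tl; clear; lia.
  rewrite halve_map rep_instance //.
  set q := side b p; have qp : oriented p q := oriented_side b p.
  have sq : size q = l by rewrite (oriented_size qp).
  have [v tv] : exists v, onth q t = Some v by apply: onth_lt_ex; rewrite sq -sp.
  move=> srt; have vx : path (adj G) v xs.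
    by apply: (@sorted_rev_path _ _ (drop t.+1 q)); rewrite -(onth_drop tv).
  have rq : rep G P q (rev xs ++ drop t q).
    apply: (@RepU _ _ _ _ _ v); rewrite ?sx //; last exact: extension_ok.
    by rewrite /u_vtx sq tl.
  exists ((rev xs ++ drop t q) :: S), (halve k (rev xs ++ drop t q) ++ S).
  have snew : size (rev xs ++ drop t q) = l.+1.
    by rewrite size_cat size_rev size_drop sx sq; move: tl; clear; lia.
  have sS' := sS sP; split.
  + exact: OpRep PS qp rq.
  + rewrite /halve; case: ltnP => hs; first exact: rt_refl.
    apply: rt_step; apply: (@Break _ _ _ (take k (rev xs ++ drop t q)) (drop k (rev xs ++ drop t q))).
    * by rewrite cat_take_drop.
    * by rewrite cat_take_drop.
    * by left; rewrite size_takel // (leq_trans _ hs) // leq_pmull.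
  + rewrite all_cat sS' andbT /halve; case: ltnP => hs /=; first by rewrite hs.
    by rewrite size_take size_drop snew; move: lk; clear; case: ifP; lia.
  + rewrite /halve; case: ifP => _ /=; last exact/perm_set_two/set_p.
    by rewrite cats0 perm_sym set_p.
- have l0 : (l == 0) = false by move: lk k0; clear; lia.
  rewrite l0 /= => sx /and4P[/andP[iP /eqP sl] xP ux].
  have [p [S [PS pE sp set_p sS]]] := set_nth_old iP sl.
  rewrite -pE; have [_ _ pin] := perm_flatten_cons PS.
  have [x [y [xsE sx1 sx2]]] : exists x y,
      [/\ xs = x ++ y, size x = k - t.+1 & size y = k - (size p - j)].
    exists (take (k - t.+1) xs), (drop (k - t.+1) xs).
    by rewrite cat_take_drop size_drop size_takel sx ?leq_addr // addKn sp.
  have [e1 e2] : [seq nth x0 (p ++ xs) a | a <- nth [::] (double_paths k l b t j) 0]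
        = take t.+1 (side b p) ++ x
    /\ [seq nth x0 (p ++ xs) a | a <- nth [::] (double_paths k l b t j) 1]
        = rev y ++ drop j (side b p).
    by rewrite xsE -sp; have := double_instance b sx1 sx2; rewrite /= => -[-> ->].
  rewrite /= in e1 e2; rewrite e1 e2.
  set q := side b p; have qp : oriented p q := oriented_side b p.
  have sq : size q = l by rewrite (oriented_size qp).
  have [v tv] : exists v, onth q t = Some v by apply: onth_lt_ex; rewrite sq; move: tl; clear; lia.
  have [w jw] : exists w, onth q j = Some w by apply: onth_lt_ex; rewrite sq; case/andP: jl.
  move=> /and3P[s1 s2 _].
  move: ux xP; rewrite xsE cat_uniq all_cat => /and3P[ux xy uy] /andP[xP yP].
  have dr : double_rep G k P q (take t.+1 q ++ x) (rev y ++ drop j q).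
    apply/double_repP; apply: (@DoubleRepSpec _ _ _ _ _ _ _ t j v w x y) => //.
    - by rewrite sq.
    - by case/andP: jl.
    - apply: extension_ok => //; apply: (@sorted_path (take t q)).
      by rewrite -cat_rcons -(onth_take tv).
    - apply: extension_ok => //; apply: (@sorted_rev_path _ _ (drop j.+1 q)).
      by rewrite -(onth_drop jw).
    - by rewrite sx1; clear; lia.
    - by rewrite sx2 sq sp; clear; lia.
  exists [:: take t.+1 q ++ x, rev y ++ drop j q & S], [:: take t.+1 q ++ x, rev y ++ drop j q & S].
  split.
  + exact: OpDoubleRep PS qp dr.
  + exact: rt_refl.
  + rewrite /= sS // andbT !size_cat size_rev size_drop size_takel ?sq ?sx1 ?sx2 ?sp; move: lk tl jl; clear; lia.
  + exact/perm_set_two/set_p.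
Qed.

Definition feasible P := exists md xs i,
  [/\ md \in modes k, size xs = ext_len md & mode_ok P xs i md].

Lemma feasible_add P x : is_path G x -> all (fun z => z \notin flatten P) x -> k <= size x -> feasible P.
Proof.
move=> px xP kx; have tk := @is_path_take _ G k _ px.
exists (add_mode k), (take k x), 0; split; first by rewrite mem_head.
  by rewrite /ext_len /= size_takel.
rewrite /mode_ok /instance /old_path /old_len /checks /= add_instance ?size_takel //.
case/andP: tk => -> ->; rewrite !andbT.
by apply/allP => z /mem_take; apply: (allP xP).
Qed.

Lemma extension_out P v x n : extension G P v x ->
  [/\ uniq (take n x), path (adj G) v (take n x) & all (fun z => z \notin flatten P) (take n x)].
Proof.
move/(extension_take n)/extensionP => [/andP[ux _] vx xP].
by split=> //; apply/allP.
Qed.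

Lemma feasible_rep P p q t v x : bounded_cover G k P -> p \in P -> oriented p q ->
  t < uphalf (size q) -> onth q t = Some v -> extension G P v x -> t < size x -> feasible P.
Proof.
move=> [[pP kP uP] sP] pin pq tq tv ex tx.
(* In the second case the extension has order at least [k], and Add applies. *)
have [tk|kt] := ltnP t k.-1; last first.
  have [px _ xP] := extensionP ex; apply: (feasible_add px); first exact/allP.
  by move: kt tx k0; lia.
have [b qE] := orientedP pq.
have sp : size q = size p := oriented_size pq.
have lk : k <= size p < 2 * k by rewrite (kP _ pin) (allP sP _ pin).
have iP : index p P < size P by rewrite index_mem.
have pE : nth [::] P (index p P) = p by rewrite nth_index.
exists (rep_mode k (size p) b t), (take t.+1 x), (index p P); split.
- by rewrite inE mem_cat; apply/or3P/Or32/rep_modesP; exists (size p), b, t; split=> //; rewrite -sp.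
- by rewrite /ext_len /= size_takel.
have [ux vx xP] := extension_out t.+1 ex.
rewrite /mode_ok /instance /old_path /old_len /checks /= pE eqxx iP ux xP orbT /=.
rewrite ifN; last by move: lk k0; clear; slia.
rewrite rep_instance ?size_takel //; last by rewrite -sp; clear -tq; slia.
rewrite -qE andbT.
have := rep_result pP pin pq tv (extension_take t.+1 ex).
by case/andP.
Qed.

(* If Rep does not apply either, the two extensions can be cut to order at most
   (k - 1) / 2 each, so that [double_modes] contains this shape. *)
Lemma feasible_double P p q t j v w x y : bounded_cover G k P -> p \in P -> oriented p q ->
  t < uphalf (size q) -> t < j -> onth q t = Some v -> onth q j = Some w ->
  extension G P v x -> extension G P w y -> ~~ has (mem x) y ->
  k <= t.+1 + size x -> k <= size q - j + size y -> feasible P.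
Proof.
move=> bP pin pq tq tj tv jw ex ey xy kx ky; have [[pP kP uP] sP] := bP.
have [xt|xt] := ltnP t (size x); first exact: (feasible_rep bP pin pq tq tv ex).
have jq := onth_lt jw.
(* A larger [y] allows Rep at [w], in the orientation that puts [w] into the first half. *)
have [ysmall|ybig] := leqP (size y) (minn j (size q - j.+1)); last first.
  have [jh|hj] := ltnP j (uphalf (size q)).
    apply: (feasible_rep bP pin pq jh jw ey).
    by move: ybig jh; clear; slia.
  apply: (@feasible_rep P p (rev q) (size q - j.+1) w y) => //.
  - exact: oriented_trans pq (or_intror erefl).
  - by rewrite size_rev; move: hj jq; clear; slia.
  - exact: onth_rev.
  - by move: ybig hj jq; clear; slia.
have [b qE] := orientedP pq.
have sp : size q = size p := oriented_size pq.
have kl : k <= size p := kP _ pin.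
have lk : k <= size p < 2 * k by rewrite kl (allP sP _ pin).
have iP : index p P < size P by rewrite index_mem.
have pE : nth [::] P (index p P) = p by rewrite nth_index.
(* From [k - t.+1 <= size x <= t] follows [2 * (k - t.+1) < k]; the other extension satisfies the
   analogous inequality. *)
have c12 : (k - t.+1) + (k - (size p - j)) < k.
  by move: kx ky xt ysmall kl k0; rewrite sp; clear; slia.
exists (double_mode k (size p) b t j), (take (k - t.+1) x ++ take (k - (size p - j)) y), (index p P).
have sx : size (take (k - t.+1) x) = k - t.+1 by rewrite size_takel //; move: kx; clear; slia.
have sy : size (take (k - (size p - j)) y) = k - (size p - j).
  by rewrite size_takel //; move: ky; rewrite sp; clear; slia.
split.
- rewrite inE mem_cat; apply/or3P/Or33/double_modesP; exists (size p), b, t, j.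
  by split=> //; rewrite -sp // tj.
- by rewrite /ext_len /= size_cat sx sy.
have [ux vx xP] := extension_out (k - t.+1) ex.
have [uy wy yP] := extension_out (k - (size p - j)) ey.
rewrite /mode_ok /instance /old_path /old_len /checks /= -/(double_paths _ _ _ _ _) pE eqxx iP.
rewrite ifN; last by move: lk k0; clear; slia.
rewrite all_cat xP yP orbT /=; apply/andP; split.
  rewrite cat_uniq ux uy andbT /=; apply/hasPn => z /mem_take zy; apply/negP => /mem_take zx.
  by move/hasPn: xy => /(_ _ zy)/negP; apply.
have := double_instance b sx sy; rewrite /= => -[-> ->].
rewrite -qE; apply/and3P; split=> //.
  have qp : is_path G q by rewrite (oriented_path _ pq) pP.
  have := is_path_take t.+1 qp; rewrite (onth_take tv) => /andP[_ st].
  by case: (take t q) st => [|a s] //=; rewrite cat_path last_rcons => ->.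
have := rep_result pP pin pq jw (extension_take (k - (size p - j)) ey).
by case/andP.
Qed.

(** The mode found may describe another operation than the given one, such as Rep or Add in place of
    DoubleRep. *)
Lemma mode_complete P P' : bounded_cover G k P -> operation G k P P' -> feasible P.
Proof.
move=> bP [p pp pk|p q S q' PS pq /repP|p q S q1 q2 PS pq /double_repP].
- by rewrite in_restE => rp; apply: (feasible_add pp rp); rewrite pk.
- have [_ _ pin] := perm_flatten_cons PS.
  case=> r t v x qr _ tv tr ex tx.
  exact: (feasible_rep bP pin (oriented_trans pq qr) tr tv ex tx).
- have [_ _ pin] := perm_flatten_cons PS.
  case=> t j a c x y tq tj ta jc ea ec xy kx ky _ _.
  exact: (feasible_double bP pin pq tq tj ta jc ea ec xy kx ky).
Qed.

End Modes.

(** * The program *)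

Opaque seqc guard_all modes.

(* Memory layout: path number p is stored in the cells [aRow i p], i < [aLen p];
   [aCov] is the characteristic function of the covered vertices; [aVar i] are
   the loop variables of the search and [aTmp i] save the vertices of an
   operation while the paths are being rewritten. *)
Definition aNum := 0.
Definition aFound := 1.
Definition aRound := 2.
Definition aOut := 3.
Definition aLen := 4.
Definition aCov := 5.
Definition aVar i := 6 + 3 * i.
Definition aRow i := 7 + 3 * i.
Definition aTmp i := 8 + 3 * i.

Definition path_index k := sc (aVar k.-1).

Definition vertex k (md : mode) a :=
  if a < old_len md then EGet (aRow a) (path_index k) else sc (aVar (a - old_len md)).

Definition old_guards k md :=
  if old_len md == 0 then [::] else
    [:: ELt (path_index k) (sc aNum); EEq (EGet aLen (path_index k)) (ECst (old_len md))].

Definition fresh_guards md :=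
  [seq EEq (EGet aCov (sc (aVar i))) (ECst 0) | i <- iota 0 (ext_len md)].

Definition uniq_guards md := flatten
  [seq [seq EEq (EEq (sc (aVar i)) (sc (aVar j))) (ECst 0) | j <- iota 0 i]
    | i <- iota 0 (ext_len md)].

Definition adj_guards k md := flatten
  [seq [seq EAdj (vertex k md (nth 0 s i)) (vertex k md (nth 0 s i.+1)) | i <- iota 0 (size s).-1]
    | s <- checks md].

Definition guards k md :=
  old_guards k md ++ fresh_guards md ++ uniq_guards md ++ adj_guards k md.

Definition save k md :=
  seqc [seq CSet (aTmp i) (ECst 0) (vertex k md i) | i <- iota 0 (old_len md + ext_len md)].

Definition uncover md := seqc [seq CSet aCov (sc (aTmp i)) (ECst 0) | i <- iota 0 (old_len md)].

Definition cover md := seqc [seq CSet aCov (sc (aTmp i)) (ECst 1) | i <- flatten (news md)].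

Definition store e s := CSeq
  (seqc [seq CSet (aRow i) e (sc (aTmp (nth 0 s i))) | i <- iota 0 (size s)])
  (CSet aLen e (ECst (size s))).

Definition append s := CSeq (store (sc aNum) s) (CSet aNum (ECst 0) (ESucc (sc aNum))).

Definition rewrite_paths k md :=
  if old_len md == 0 then seqc (map append (news md))
  else CSeq (store (path_index k) (head [::] (news md))) (seqc (map append (behead (news md)))).

(** Vertices that stay are uncovered and covered again, which avoids computing the set of dropped
    vertices. *)
Definition perform k md :=
  CSeq (save k md) (CSeq (uncover md) (CSeq (cover md) (CSeq (rewrite_paths k md)
    (CSet aFound (ECst 0) (ECst 1))))).

Definition attempt k md :=
  CIf (guard_all (EEq (sc aFound) (ECst 0) :: guards k md)) (perform k md) CSkip.

(** The number of modes depends on [k] only, so they are unrolled and only the [k] variables cost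
    loops. *)
Fixpoint search k m :=
  if m is m'.+1 then CFor (aVar m') (search k m') else seqc [seq attempt k md | md <- modes k].

(** Orders are below [2 * k], so the positions in a row are unrolled and a single loop over the rows
    remains. *)
Definition emit k := CSeq
  (CFor aOut (CIf (ELt (sc aOut) (sc aNum))
    (CSeq (seqc [seq CIf (ELt (ECst i) (EGet aLen (sc aOut))) (CWrite (EGet (aRow i) (sc aOut))) CSkip
                | i <- iota 0 (2 * k)])
          (CWrite EOrder)) CSkip))
  (CWrite (ESucc EOrder)).

(** The first number written encodes the initial empty collection. Rounds after the last successful
    search are idle. *)
Definition approx1 k := CSeq (CWrite (ESucc EOrder))
  (CFor aRound (CSeq (CSet aFound (ECst 0) (ECst 0))
    (CSeq (search k k) (CIf (sc aFound) (emit k) CSkip)))).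

Lemma loop_depth_attempt k md : loop_depth (attempt k md) = 0.
Proof.
have Hs e s : loop_depth (store e s) = 0 by rewrite /= loop_depth_seqc.
have Ha s : loop_depth (append s) = 0 by rewrite /append [loop_depth _]/= loop_depth_seqc.
rewrite /= maxn0 /save /uncover /cover !loop_depth_seqc // /rewrite_paths.
by case: ifP => _; rewrite ?[loop_depth (CSeq _ _)]/= !loop_depth_seqc.
Qed.

Lemma loop_depth_search k m : loop_depth (search k m) = m.
Proof.
elim: m => [|m IH] /=; last by rewrite IH maxn0 max0n.
by apply: loop_depth_seqc; apply: loop_depth_attempt.
Qed.

Lemma loop_depth_approx1 k : 0 < k -> loop_depth (approx1 k) = k.+1.
Proof.
move=> k0; rewrite /= loop_depth_search loop_depth_seqc // !(maxn0, max0n).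
by case: k k0 => // k _; rewrite maxnSS maxn0.
Qed.

Ltac arrays := rewrite /aNum /aFound /aRound /aOut /aLen /aCov /aVar /aRow /aTmp; lia.

Lemma modifies_store e s a : (forall i, a != aRow i) -> a != aLen -> ~~ modifies (store e s) a.
Proof. by move=> ra la; rewrite /= (negPf la) orbF; apply: modifies_seqc => i /=. Qed.

Lemma modifies_append s a : (forall i, a != aRow i) -> a != aLen -> a != aNum -> ~~ modifies (append s) a.
Proof. by move=> ra la na; rewrite /append [modifies _ _]/= -/(modifies (store _ _) a) negb_or na andbT; apply: modifies_store. Qed.

Lemma modifies_rewrite k md a : (forall i, a != aRow i) -> a != aLen -> a != aNum ->
  ~~ modifies (rewrite_paths k md) a.
Proof.
move=> ra la na; have H l : ~~ modifies (seqc (map append l)) a.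
  by apply: modifies_seqc => s; apply: modifies_append.
rewrite /rewrite_paths; case: ifP => // _.
by rewrite [modifies _ _]/= -/(modifies (store _ _) a) negb_or H andbT; apply: modifies_store.
Qed.

Lemma modifies_save k md a : (forall i, a != aTmp i) -> ~~ modifies (save k md) a.
Proof. by move=> ta; apply: modifies_seqc => i /=. Qed.

Lemma modifies_uncover md a : a != aCov -> ~~ modifies (uncover md) a.
Proof. by move=> ca; apply: modifies_seqc => i /=. Qed.

Lemma modifies_cover md a : a != aCov -> ~~ modifies (cover md) a.
Proof. by move=> ca; apply: modifies_seqc => i /=. Qed.

(** The loop counters, which hold no part of the collection; bounding [i] by [a] keeps the predicate
    boolean. *)
Definition control a := (a == aRound) || (a == aOut) || [exists i : 'I_a, a == aVar i].

Lemma control_other a : control a -> [/\ forall i, a != aRow i, forall i, a != aTmp i,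
  a != aLen, a != aNum & (a != aCov) && (a != aFound)].
Proof.
move=> ca; have aE : a = aRound \/ a = aOut \/ exists i, a = aVar i.
  case/orP: ca => [/orP[/eqP->|/eqP->]|/existsP[i /eqP e]]; [by left|by right; left|].
  by right; right; exists i.
by split=> [i|i|||]; case: aE => [->|[->|[j ->]]]; arrays.
Qed.

Lemma modifies_search k m a : control a -> (forall i, i < m -> a != aVar i) ->
  ~~ modifies (search k m) a.
Proof.
move=> ca; have [ra ta la na /andP[va fa]] := control_other ca.
elim: m => [|m IH] am /=.
  apply: modifies_seqc => md /=.
  rewrite !negb_or modifies_save // modifies_uncover // modifies_cover // modifies_rewrite //=.
  by rewrite fa.
by rewrite !negb_or am // andbT; apply: IH => i im; apply: am; rewrite ltnS ltnW.
Qed.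

Lemma control_var i : control (aVar i).
Proof.
have lt : i < aVar i by arrays.
by rewrite /control; apply/orP; right; apply/existsP; exists (Ordinal lt).
Qed.

Lemma all_flatten_seq (T : Type) (p : pred T) ss : all p (flatten ss) = all (all p) ss.
Proof. by elim: ss => //= s ss IH; rewrite all_cat IH. Qed.

Lemma uniq_mkseq_all (T : eqType) (f : nat -> T) m :
  uniq (mkseq f m) = all (fun i => all (fun j => f i != f j) (iota 0 i)) (iota 0 m).
Proof.
elim: m => // m IH; rewrite mkseqS rcons_uniq IH -[in RHS]addn1 iotaD all_cat /= andbT andbC.
congr (_ && _); rewrite /mkseq; elim: (iota 0 m) => //= a s IHs.
by rewrite inE negb_or IHs.
Qed.

(** * Storing and rewriting a collection in memory *)

Section Semantics.
Variables (n : nat) (G : sgraph 'I_n) (k : nat).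
Implicit Types (M : memory) (o : seq nat) (P : coll 'I_n).

Definition stored M (R : seq (seq nat)) := [/\ M aNum 0 = size R,
  forall p, p < size R -> M aLen p = size (nth [::] R p) &
  forall p i, p < size R -> i < size (nth [::] R p) -> M (aRow i) p = nth 0 (nth [::] R p) i].

Definition marked M P := forall v : 'I_n, M aCov v = (v \in flatten P).

Definition rows P : seq (seq nat) := [seq [seq val v | v <- p] | p <- P].

Definition tmp M a := M (aTmp a) 0.

Lemma stored_eq M M' R : (forall i, M' (aRow i) =1 M (aRow i)) -> M' aLen =1 M aLen ->
  M' aNum =1 M aNum -> stored M R -> stored M' R.
Proof.
move=> eR eL eN [h1 h2 h3]; split=> [|p pR|p i pR ip]; rewrite ?eN ?eL ?eR //.
- exact: h2.
- exact: h3.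
Qed.

Definition off_rows M M' := forall a, (forall i, a != aRow i) -> a != aLen -> M' a =1 M a.

(** The row number is evaluated anew at each write, so [e] must keep its value while rows and
    lengths change. *)
Lemma exec_store M o e s r :
  (forall M', off_rows M M' -> eval G M' e = r) ->
  exec G (store e s) (M, o) (fun s' => [/\ s'.2 = o, off_rows M s'.1,
    s'.1 aLen r = size s /\ (forall p, p != r -> s'.1 aLen p = M aLen p),
    forall i, i < size s -> s'.1 (aRow i) r = tmp M (nth 0 s i) &
    forall i p, p != r -> s'.1 (aRow i) p = M (aRow i) p]).
Proof.
move=> er; apply: exec_seq.
pose Inv i (s' : memory * seq nat) := [/\ s'.2 = o, off_rows M s'.1,
    s'.1 aLen =1 M aLen, forall j, j < i -> s'.1 (aRow j) r = tmp M (nth 0 s j) &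
    forall i p, p != r -> s'.1 (aRow i) p = M (aRow i) p].
apply: exec_weaken; first apply: (@exec_iota n G _ Inv).
- by split.
- move=> i [M1 o1] im [/= -> off len row oth].
  apply: exec_set; rewrite er //=; split=> //=.
  + by move=> a ra la j; rewrite update_other ?off.
  + move=> j; rewrite ltnS leq_eqVlt => /predU1P[->|ji].
      by rewrite update_same /tmp off //; arrays.
    rewrite update_other ?row //; arrays.
  + move=> j p pr; rewrite updateE (negPf pr) andbF; exact: oth.
- move=> [M1 o1] [/= -> off len row oth].
  apply: exec_set; rewrite er //=; split=> //=.
  + by move=> a ra la j; rewrite update_other ?off.
  + split; first by rewrite update_same.
    by move=> p pr; rewrite updateE (negPf pr) andbF.
Qed.

Lemma exec_store_set M o e s r R : stored M R -> r < size R ->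
  (forall M', off_rows M M' -> eval G M' e = r) ->
  exec G (store e s) (M, o) (fun s' => [/\ s'.2 = o, off_rows M s'.1 &
    stored s'.1 (set_nth [::] R r (map (tmp M) s))]).
Proof.
move=> [h1 h2 h3] rR er; apply: exec_weaken (exec_store o s er) _.
move=> [M1 o1] [/= -> off [lr len] rowr row]; split=> //.
have sR : size (set_nth [::] R r (map (tmp M) s)) = size R.
  by rewrite size_set_nth; apply/maxn_idPr.
split; first by rewrite sR off //; arrays.
- move=> p; rewrite sR nth_set_nth /= => pR; case: eqP => [->|/eqP pr].
    by rewrite lr size_map.
  by rewrite len // h2.
- move=> p i; rewrite sR nth_set_nth /= => pR; case: eqP => [->|/eqP pr].
    by rewrite size_map => im; rewrite rowr // (nth_map 0).
  by move=> ip; rewrite row // h3.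
Qed.

Definition off_coll M M' :=
  forall a, (forall i, a != aRow i) -> a != aLen -> a != aNum -> M' a =1 M a.

Lemma exec_append M o s R : stored M R ->
  exec G (append s) (M, o) (fun s' => [/\ s'.2 = o, off_coll M s'.1 &
    stored s'.1 (rcons R (map (tmp M) s))]).
Proof.
move=> [h1 h2 h3]; apply: exec_seq.
have er M' : off_rows M M' -> eval G M' (sc aNum) = size R.
  by move=> off /=; rewrite off ?h1 //; arrays.
apply: exec_weaken (exec_store o s er) _.
move=> [M1 o1] [/= -> off [lr len] rowr row]; apply: exec_set => /=.
have nM1 : M1 aNum 0 = size R by rewrite off ?h1 //; arrays.
split=> //=; first by move=> a ra la na j; rewrite update_other ?off.
split; first by rewrite update_same nM1 size_rcons.
- move=> p; rewrite size_rcons ltnS update_other; last by arrays.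
  rewrite nth_rcons leq_eqVlt => /predU1P[->|pR]; first by rewrite ltnn eqxx lr size_map.
  by rewrite pR len ?h2 // ltn_eqF.
- move=> p i; rewrite size_rcons ltnS update_other; last by arrays.
  rewrite nth_rcons leq_eqVlt => /predU1P[->|pR].
    by rewrite ltnn eqxx size_map => im; rewrite rowr // (nth_map 0).
  by rewrite pR => ip; rewrite row ?h3 // ltn_eqF.
Qed.

Lemma exec_appends M o l R : stored M R ->
  exec G (seqc (map append l)) (M, o) (fun s' => [/\ s'.2 = o, off_coll M s'.1 &
    stored s'.1 (R ++ [seq map (tmp M) s | s <- l])]).
Proof.
move=> st.
have := @exec_seqc n G (seq nat) [::] append (fun i s' => [/\ s'.2 = o, off_coll M s'.1 &
    stored s'.1 (R ++ [seq map (tmp M) s | s <- take i l])]) l (M, o).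
rewrite take0 cats0 take_size; apply; first by split.
move=> i [M1 o1] il [/= -> off st1]; apply: exec_weaken (exec_append _ _ st1) _.
move=> [M2 o2] [/= -> off2 st2]; split=> //.
  by move=> a ra la na j; rewrite off2 ?off.
rewrite (take_nth [::]) // map_rcons -rcons_cat.
have <- // : map (tmp M1) (nth [::] l i) = map (tmp M) (nth [::] l i).
by apply: eq_map => a; rewrite /tmp off //; arrays.
Qed.

Definition new_rows md M R r :=
  let new := [seq map (tmp M) s | s <- news md] in
  if old_len md == 0 then R ++ new else set_nth [::] R r (head [::] new) ++ behead new.

Lemma exec_rewrite M o md R r : stored M R -> M (aVar k.-1) 0 = r ->
  (old_len md == 0) || (r < size R) -> news md != [::] ->
  exec G (rewrite_paths k md) (M, o) (fun s' => [/\ s'.2 = o, off_coll M s'.1 &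
    stored s'.1 (new_rows md M R r)]).
Proof.
move=> st wr rR; rewrite /rewrite_paths /new_rows; move: rR; case: ifP => _ /= rR nnew.
  exact: exec_appends.
case: (news md) nnew => // s l _; apply: exec_seq.
have er M' : off_rows M M' -> eval G M' (path_index k) = r.
  by move=> off /=; rewrite off ?wr //; arrays.
apply: exec_weaken (exec_store_set o s st rR er) _ => -[M1 o1] [/= -> off st1].
apply: exec_weaken (exec_appends _ _ st1) _ => -[M2 o2] [/= -> off2 st2]; split=> //.
  by move=> a ra la na j; rewrite off2 ?off.
have <- // : map (map (tmp M1)) l = map (map (tmp M)) l.
by apply: eq_map => s'; apply: eq_map => a; rewrite /tmp off //; arrays.
Qed.

End Semantics.

(** * Testing and performing one mode *)

Section Attempt.
Variables (n : nat) (G : sgraph 'I_n) (k : nat).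
Hypothesis k0 : 0 < k.
Implicit Types (M : memory) (o : seq nat) (P : coll 'I_n) (w : nat -> 'I_n).

Definition candidate w m : seq 'I_n := mkseq w m.

(** [w] assigns values to the search variables: the first [ext_len md] are the extension vertices,
    [w k.-1] serves as path number, and [w 0] is merely a default. *)
Definition passes P w md :=
  mode_ok G (w 0) P (candidate w (ext_len md)) (w k.-1) md.

Definition outcome P w md :=
  mode_result (w 0) P (candidate w (ext_len md)) (w k.-1) md.

Definition actual P w md := old_path P (w k.-1) md ++ candidate w (ext_len md).

Definition represents M P := stored M (rows P) /\ marked M P.

Lemma rows_size P : size (rows P) = size P.
Proof. exact: size_map. Qed.

Lemma nth_rows P p : p < size P -> nth [::] (rows P) p = [seq val v | v <- nth [::] P p].
Proof. by move=> pP; rewrite (nth_map [::]). Qed.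

Lemma eval_vertex M P w md a : represents M P -> (forall i, i < k -> M (aVar i) 0 = w i) ->
  (old_len md == 0) || (w k.-1 < size P) && (size (nth [::] P (w k.-1)) == old_len md) ->
  ext_len md <= k -> a < old_len md + ext_len md ->
  eval G M (vertex k md a) = val (nth (w 0) (actual P w md) a).
Proof.
move=> [[_ _ st] _] vM old ek al; rewrite /vertex /actual /old_path.
have [ao|oa] := ltnP a (old_len md); last first.
  rewrite /= vM; last by lia.
  rewrite nth_cat; move: old; case: eqP => [l0|_] /= => [_|/andP[_ /eqP->]].
    by rewrite l0 subn0 in al *; rewrite nth_mkseq.
  by rewrite ltnNge oa /= nth_mkseq //; lia.
move: old; rewrite ifN /=; last by lia.
have -> /= : (old_len md == 0) = false by lia.
case/andP=> wP /eqP so; rewrite vM; last by lia.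
rewrite st ?rows_size // nth_rows ?size_map ?so // (nth_map (w 0)) ?so //.
by rewrite nth_cat so ao.
Qed.

Lemma adj_natE (x y : 'I_n) : adj_nat G (val x) (val y) = adj G x y.
Proof. by rewrite /adj_nat !valK. Qed.

Lemma eval_guards M P w md : represents M P -> (forall i, i < k -> M (aVar i) 0 = w i) ->
  md \in modes k ->
  all (fun e => eval G M e != 0) (guards k md) = passes P w md.
Proof.
move=> rep vM mdk; have [wf_checks _ _ ek _] := mode_wf k0 mdk.
have [[hN hL _] mk] := rep.
rewrite /passes /mode_ok /guards !all_cat; set old := (_ || _).
have -> : all (fun e => eval G M e != 0) (old_guards k md) = old.
  rewrite /old_guards /old; case: eqP => //= _.
  rewrite vM ?prednK // hN rows_size andbT !eqb0 !negbK.
  by case: ltnP => //= wP; rewrite hL ?rows_size // nth_rows // size_map.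
case: (boolP old) => // oldP /=.
have -> : all (fun e => eval G M e != 0) (fresh_guards md)
    = all (fun v => v \notin flatten P) (candidate w (ext_len md)).
  rewrite /fresh_guards /candidate /mkseq !all_map; apply: eq_in_all => i.
  rewrite mem_iota /= => ie; rewrite vM; last by lia.
  by rewrite mk; case: (_ \in _).
have -> : all (fun e => eval G M e != 0) (uniq_guards md) = uniq (candidate w (ext_len md)).
  rewrite uniq_mkseq_all /uniq_guards all_flatten_seq all_map; apply: eq_in_all => i.
  rewrite mem_iota /= => ie; rewrite all_map; apply: eq_in_all => j.
  rewrite mem_iota /= => ji; rewrite !vM; try by lia.
  by rewrite -(inj_eq val_inj) !eqb0 !negbK.
congr [&& _, _ & _]; rewrite /adj_guards all_flatten_seq !all_map.
apply: eq_in_all => s sc; rewrite /= all_map.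
have sl a : a \in s -> a < old_len md + ext_len md.
  by move=> ins; apply: (allP wf_checks); apply/flattenP; exists s.
have ev a : a \in s -> eval G M (vertex k md a) = val (nth (w 0) (actual P w md) a).
  by move=> ins; apply: (eval_vertex rep vM oldP ek (sl _ ins)).
have step i : i.+1 < size s ->
    (eval G M (EAdj (vertex k md (nth 0 s i)) (vertex k md (nth 0 s i.+1))) != 0)
    = adj G (nth (w 0) [seq nth (w 0) (actual P w md) a | a <- s] i)
        (nth (w 0) [seq nth (w 0) (actual P w md) a | a <- s] i.+1).
  move=> is_; rewrite /= !ev ?mem_nth ?(ltnW is_) // eqb0 negbK adj_natE.
  by rewrite !(nth_map 0) // ltnW.
apply/allP/(sortedP (w 0)) => [H i|H i].
  rewrite size_map => is_; rewrite -step //; apply: H.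
  by rewrite mem_iota add0n ltn_predRL.
rewrite mem_iota add0n ltn_predRL => is_; rewrite [preim _ _ _]step //.
by apply: H; rewrite size_map.
Qed.

(** Since the members are disjoint, dropping a row amounts to dropping its vertices; this is how the
    program updates [aCov]. *)
Lemma mem_mode_result P w md : bounded_cover G k P -> md \in modes k -> passes P w md ->
  flatten (outcome P w md) =i [predU [predD flatten P & old_path P (w k.-1) md] &
    flatten (instance (w 0) P (candidate w (ext_len md)) (w k.-1) md (news md))].
Proof.
move=> [[_ _ uP] _] mdk /andP[old _] v; have [_ _ _ _ nnew] := mode_wf k0 mdk.
rewrite !inE /outcome /mode_result; set new := instance _ _ _ _ _ _.
have : new != [::] by rewrite /new /instance; case: (news md) nnew.
rewrite /old_path; move: old new; case: eqP => _ /= old new.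
  by rewrite flatten_cat mem_cat.
case: new => // a l _ /=; case/andP: old => wP _.
have [p [S [PS pE _ set_p _]]] := @set_nth_old _ k P (w k.-1) _ wP erefl.
rewrite flatten_cat mem_cat (perm_mem (perm_flatten (set_p a))) /= -pE.
rewrite (perm_mem (perm_flatten PS)) /= !mem_cat.
move: uP; rewrite (perm_uniq (perm_flatten PS)) /= cat_uniq => /and3P[_ /hasPn pS _].
have : v \in flatten S -> v \notin p by move/pS.
by case: (v \in flatten S) => [/(_ isT)/negPf->|_]; case: (v \in p); case: (v \in a); case: (v \in flatten l).
Qed.

Lemma exec_perform M o P w md : bounded_cover G k P -> md \in modes k ->
  represents M P -> (forall i, i < k -> M (aVar i) 0 = w i) -> passes P w md ->
  exec G (perform k md) (M, o) (fun s' => [/\ s'.2 = o, s'.1 aFound 0 = 1 &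
    represents s'.1 (outcome P w md)]).
Proof.
move=> bP mdk rep vM pass; have old : _ := proj1 (andP pass).
have [_ wf_news oe ek nnew] := mode_wf k0 mdk.
have [st mk] := rep.
pose L := actual P w md; pose q := old_path P (w k.-1) md.
have sq : size q = old_len md.
  by move: old; rewrite /q /old_path; case: eqP => [->|_ /andP[_ /eqP]].
have sL : size L = old_len md + ext_len md by rewrite size_cat size_mkseq -/q sq.
apply: exec_seq; apply: exec_weaken.
  apply: (@exec_iota n G _ (fun i s' => [/\ s'.2 = o,
    forall a, (forall i, a != aTmp i) -> s'.1 a =1 M a &
    forall a, a < i -> tmp s'.1 a = val (nth (w 0) L a)])); first by split.
  move=> i [M1 o1] il [/= -> off tm]; apply: exec_set.
  have -> : eval G M1 (vertex k md i) = eval G M (vertex k md i).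
    rewrite /vertex; case: ifP => _ /=; rewrite !off //; try (by move=> j; arrays).
  split=> //=; first by move=> a ta j; rewrite update_other ?off.
  move=> a; rewrite ltnS leq_eqVlt /tmp => /predU1P[->|ai].
    by rewrite update_same; apply: (eval_vertex rep vM old ek il).
  by rewrite update_other; [apply: tm|move: ai; clear; arrays].
move=> [M1 o1] [/= -> off1 tm1]; apply: exec_seq; apply: exec_weaken.
  apply: (@exec_iota n G _ (fun i s' => [/\ s'.2 = o,
    forall a, a != aCov -> s'.1 a =1 M1 a &
    forall v : 'I_n, s'.1 aCov v = (v \in flatten P) && (v \notin take i q)])).
    by split=> //= v; rewrite take0 andbT off1 // => j; arrays.
  move=> i [M2 o2] il [/= -> off mk2]; apply: exec_set.
  have -> : eval G M2 (sc (aTmp i)) = val (nth (w 0) q i).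
    rewrite /= off; last by arrays.
    by rewrite -/(tmp M1 i) tm1 ?(leq_trans il) ?leq_addr // nth_cat sq il.
  split=> //=; first by move=> a ca j; rewrite update_other ?off.
  move=> v; rewrite updateE eqxx (take_nth (w 0)) ?sq // mem_rcons inE negb_or.
  rewrite -(inj_eq val_inj) /= mk2; case: eqP => //= _; by rewrite andbF.
move=> [M2 o2] [/= -> off2 mk2]; apply: exec_seq; apply: exec_weaken.
  apply: (@exec_seqc n G nat 0 _ (fun i s' => [/\ s'.2 = o,
    forall a, a != aCov -> s'.1 a =1 M1 a &
    forall v : 'I_n, s'.1 aCov v = [&& v \in flatten P & v \notin q]
      || (v \in [seq nth (w 0) L a | a <- take i (flatten (news md))])])).
    by split=> //= v; rewrite take0 orbF mk2 -sq take_size.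
  move=> i [M3 o3] il [/= -> off mk3]; apply: exec_set.
  set a := nth 0 _ i; have al : a < old_len md + ext_len md.
    by apply: (allP wf_news); apply: mem_nth.
  have -> : eval G M3 (sc (aTmp a)) = val (nth (w 0) L a).
    by rewrite /= off; [rewrite -/(tmp M1 a) tm1|arrays].
  split=> //=; first by move=> b cb j; rewrite update_other ?off.
  move=> v; rewrite updateE eqxx (take_nth 0) // map_rcons mem_rcons inE -/a.
  by rewrite -(inj_eq val_inj) /= mk3; case: eqP => //= _; rewrite orbT.
move=> [M3 o3] [/= -> off3 mk3].
have st3 : stored M3 (rows P).
  by apply: stored_eq st => [i j|j|j]; rewrite off3 ?off1 //; arrays.
have v3 : M3 (aVar k.-1) 0 = w k.-1.
  by rewrite off3 ?off1 ?vM ?prednK //; arrays.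
apply: exec_seq.
have oldR : (old_len md == 0) || (w k.-1 < size (rows P)).
  by rewrite rows_size; case/orP: old => [->//|/andP[-> _]]; rewrite orbT.
apply: exec_weaken (exec_rewrite G o st3 v3 oldR nnew) _ => -[M4 o4] [/= -> off4 st4].
apply: exec_set; split=> //.
have newE : [seq map (tmp M3) s | s <- news md]
    = rows (instance (w 0) P (candidate w (ext_len md)) (w k.-1) md (news md)).
  rewrite /rows /instance -map_comp; apply/eq_in_map => s sn /=.
  rewrite -map_comp; apply/eq_in_map => a ins /=.
  rewrite /tmp off3; last by arrays.
  apply: tm1; apply: (allP wf_news); apply/flattenP; by exists s.
split.
  have -> : rows (outcome P w md) = new_rows md M3 (rows P) (w k.-1).
    rewrite /new_rows newE /outcome /mode_result; case: ifP => _.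
      by rewrite /rows map_cat.
    rewrite /rows map_cat behead_map; congr (_ ++ _).
    apply: (@eq_from_nth _ [::]).
      by rewrite size_map !size_set_nth size_map.
    move=> i; rewrite size_map => il; rewrite (nth_map [::]) // !nth_set_nth /=.
    case: eqP => _; last first.
      have [iP|Pi] := ltnP i (size P); first by rewrite (nth_map [::]).
      by rewrite !nth_default // size_map.
    by case: (instance _ _ _ _ _ _).
  apply: stored_eq st4 => [i j|j|j]; rewrite /= update_other //; arrays.
move=> v /=; rewrite update_other; last by arrays.
rewrite off4 //.
rewrite mk3 take_size mem_mode_result // !inE; congr (nat_of_bool (_ || _)).
  by rewrite andbC.
by rewrite /instance map_flatten.
Qed.

End Attempt.

(** * The search and the main loop *)

Section Run.
Variables (n : nat) (G : sgraph 'I_n) (k : nat).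
Hypothesis k0 : 0 < k.
Implicit Types (M : memory) (o : seq nat) (P : coll 'I_n) (w : nat -> 'I_n).

Lemma represents_update M P a x : control a -> represents M P -> represents (update M a 0 x) P.
Proof.
move=> /control_other[ra _ la na /andP[ca _]] [st mk]; split.
  by apply: stored_eq st => [i j|j|j]; rewrite update_other // eq_sym.
by move=> v; rewrite update_other // eq_sym.
Qed.

(** Once the flag is set, the memory holds the collection after the round, while [P] remains the one
    before it. *)
Definition searching P M :=
  (M aFound 0 = 0 /\ represents M P) \/
  (M aFound 0 = 1 /\ exists2 P', round G k P P' & represents M P').

Lemma searching_update P M a x : control a -> searching P M -> searching P (update M a 0 x).
Proof.
move=> ca; have fa : aFound != a.
  by have [_ _ _ _ /andP[_]] := control_other ca; rewrite eq_sym.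
case=> [[f0 rep]|[f1 [P' PP' rep]]]; [left|right]; rewrite update_other //; split=> //.
  exact: represents_update.
by exists P' => //; apply: represents_update.
Qed.

Lemma passes_eq P w w' md : md \in modes k -> (forall j, j < k -> w' j = w j) ->
  passes G k P w' md = passes G k P w md.
Proof.
move=> mdk ww; have [_ _ _ ek _] := mode_wf k0 mdk.
have cE : candidate w' (ext_len md) = candidate w (ext_len md).
  by apply/eq_in_map => j; rewrite mem_iota => /andP[_ je]; apply: ww; apply: leq_trans ek.
by rewrite /passes cE !ww ?prednK.
Qed.

Lemma exec_attempt M o P w md : bounded_cover G k P -> md \in modes k ->
  (forall j, j < k -> M (aVar j) 0 = w j) -> searching P M ->
  exec G (attempt k md) (M, o) (fun s' => [/\ s'.2 = o, searching P s'.1 &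
    s'.1 aFound 0 = 0 -> M aFound 0 = 0 /\ ~~ passes G k P w md]).
Proof.
move=> bP mdk vM sM.
have cE : eval G M (guard_all (EEq (sc aFound) (ECst 0) :: guards k md))
    = (M aFound 0 == 0) && all (fun e => eval G M e != 0) (guards k md) :> nat.
  by rewrite eval_guard_all /= eqb0 negbK.
apply: exec_if; rewrite [fst _]/= cE => e.
  have {e} /andP[/eqP f0 gs] : (M aFound 0 == 0) && all (fun e => eval G M e != 0) (guards k md).
    by case: (_ && _) e.
  case: sM => [[_ rep]|[]]; last by rewrite f0.
  move: gs; rewrite (eval_guards G k0 rep vM mdk) => pass.
  apply: exec_weaken (exec_perform k0 o bP mdk rep vM pass) _ => -[M1 o1] [/= -> f1 rep1].
  split=> //; last by rewrite f1.
  right; split=> //; exists (outcome k P w md) => //.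
  by apply: mode_sound pass => //; rewrite size_mkseq.
apply: exec_skip; split=> //= f0; split=> //; move: e; rewrite f0 eqxx /=.
case: sM => [[_ rep]|[]]; last by rewrite f0.
by rewrite (eval_guards G k0 rep vM mdk); case: passes.
Qed.

Lemma exec_search_body M o P w : bounded_cover G k P ->
  (forall j, j < k -> M (aVar j) 0 = w j) -> searching P M ->
  exec G (search k 0) (M, o) (fun s' => [/\ s'.2 = o, searching P s'.1 &
    s'.1 aFound 0 = 0 -> M aFound 0 = 0 /\ all (fun md => ~~ passes G k P w md) (modes k)]).
Proof.
move=> bP vM sM; apply: exec_weaken.
  apply: (@exec_seqc n G _ (add_mode k) _ (fun i s' => [/\ s'.2 = o, searching P s'.1,
    forall j, j < k -> s'.1 (aVar j) 0 = w j &
    s'.1 aFound 0 = 0 -> M aFound 0 = 0 /\ all (fun md => ~~ passes G k P w md) (take i (modes k))])).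
    by rewrite take0.
  move=> i [M1 o1] il [/= -> s1 v1 none1].
  have mdk : nth (add_mode k) (modes k) i \in modes k by apply: mem_nth.
  apply: exec_weaken (exec_frame (exec_attempt o bP mdk v1 s1)) _.
  move=> [M2 o2] [[/= -> s2 none2] fr]; split=> //.
    move=> j jk; rewrite fr ?v1 //.
    have [ra ta la na /andP[ca fa]] := control_other (control_var j).
    by rewrite !negb_or modifies_save // modifies_uncover // modifies_cover // modifies_rewrite //= fa.
  move=> /none2[f1 np]; have [f0 al] := none1 f1; split=> //.
  by rewrite (take_nth (add_mode k)) // all_rcons np.
by move=> [M1 o1] [/= -> s1 _]; rewrite take_size.
Qed.

(** No attempt resets the flag, so a flag 0 at the end means that it was 0 throughout and that every
    assignment compatible with the outer variables was tested on [P] in vain. *)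
Lemma exec_search m M o P w : m <= k -> bounded_cover G k P ->
  (forall j, m <= j < k -> M (aVar j) 0 = w j) -> searching P M ->
  exec G (search k m) (M, o) (fun s' => [/\ s'.2 = o, searching P s'.1 &
    s'.1 aFound 0 = 0 -> M aFound 0 = 0 /\
      forall w', (forall j, m <= j < k -> w' j = w j) ->
        all (fun md => ~~ passes G k P w' md) (modes k)]).
Proof.
move=> mk bP; elim: m mk M o w => [|m IH] mk M o w vM sM.
  apply: exec_weaken (exec_search_body o bP vM sM) _ => -[M1 o1] [/= -> s1 none]; split=> //.
  move=> /none[f0 al]; split=> // w' ww; apply/allP => md mdk.
  by rewrite (passes_eq _ mdk ww) (allP al).
apply: exec_weaken; first apply: (@exec_for n G (fun i s => [/\ s.2 = o, searching P s.1,
    forall j, m < j < k -> s.1 (aVar j) 0 = w j &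
    s.1 aFound 0 = 0 -> M aFound 0 = 0 /\ forall w', (forall j, m < j < k -> w' j = w j) ->
      w' m < i -> all (fun md => ~~ passes G k P w' md) (modes k)])).
- apply: modifies_search; first exact: control_var.
  by move=> i im; apply/eqP; move: im; arrays.
- split=> //=; first by apply: searching_update => //; apply: control_var.
  by move=> j jm; rewrite update_other ?vM //; apply/eqP; move: jm; arrays.
- move=> i [M1 o1] il /= v1 [/= -> s1 vM1 none1].
  (* The current counter becomes a fixed outer variable of the inner search. *)
  pose wi j := if j == m then Ordinal il else w j.
  have vi j : m <= j < k -> M1 (aVar j) 0 = wi j.
    rewrite /wi leq_eqVlt eq_sym; case: eqP => [->|_] //= jm; exact: vM1.
  apply: exec_weaken (exec_frame (IH (ltnW mk) M1 o wi vi s1)) _.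
  move=> [M2 o2] [[/= -> s2 none2] fr]; split=> //.
  + by apply: searching_update => //; apply: control_var.
  + move=> j jm; rewrite update_other; last by apply/eqP; move: jm; arrays.
    rewrite fr ?vM1 //; apply: modifies_search; first exact: control_var.
    by move=> a am; apply/eqP; move: am jm; arrays.
  + rewrite update_other // => /none2[f1 al]; have [f0 al1] := none1 f1; split=> // w' ww.
    rewrite ltnS leq_eqVlt => /predU1P[wm|wm]; last exact: al1.
    apply: al => j; rewrite /wi leq_eqVlt eq_sym; case: eqP => [->|_] /= jm.
      exact: val_inj.
    exact: ww.
move=> [M1 o1] [/= -> s1 _ none]; split=> // /none[f0 al]; split=> // w' ww.
exact: al.
Qed.

Lemma searched_stuck P (x0 : 'I_n) : bounded_cover G k P ->
  (forall w, all (fun md => ~~ passes G k P w md) (modes k)) -> ~ exists Q, operation G k P Q.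
Proof.
move=> bP none [Q op]; have [md [xs [i [mdk sx ok]]]] := mode_complete x0 k0 bP op.
have [wf _ oe ek _] := mode_wf k0 mdk.
have iE : exists i' : 'I_n, (old_len md == 0) || (i == i').
  case: eqP => [_|l0]; first by exists x0.
  have ip : i < size P by move: ok; rewrite /mode_ok; case: eqP l0 => // _ _ /and4P[/andP[]].
  have il : i < n.
    by apply: leq_trans ip _; have := size_bounded_cover k0 bP.1; rewrite card_ord.
  by exists (Ordinal il) => /=.
case: iE => i' iE.
(* Outside Add, fewer than [k] extension vertices leave the last variable free for the path
   number. *)
pose w j := if (old_len md != 0) && (j == k.-1) then i' else nth x0 xs j.
have cE : candidate w (ext_len md) = xs.
  rewrite -sx; apply: (@eq_from_nth _ x0); rewrite size_mkseq // => j jx.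
  rewrite nth_mkseq // /w; case: ifP => // /andP[l0 /eqP jk].
  by move: oe; rewrite (negPf l0) /= -sx; move: jx; rewrite jk; lia.
have/negP[] := allP (none w) md mdk.
rewrite /passes cE /mode_ok.
have instE x y j j' ss : all (fun a => a < old_len md + ext_len md) (flatten ss) ->
    (old_len md == 0) || (j == j') ->
    (old_len md == 0) || (size (nth [::] P j) == old_len md) ->
    instance x P xs j md ss = instance y P xs j' md ss.
  move=> wfs jj' old; rewrite /instance; apply/eq_in_map => s ins; apply/eq_in_map => a ina.
  have -> : old_path P j' md = old_path P j md.
    by rewrite /old_path; move: jj'; case: eqP => //= _ /eqP->.
  apply: set_nth_default; rewrite size_cat sx.
  have : size (old_path P j md) = old_len md by rewrite /old_path; move: old; case: eqP => [->|_ /eqP].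
  by move=> ->; apply: (allP wfs); apply/flattenP; exists s.
case/and4P: ok => old xP ux srt.
have old' : (old_len md == 0) || (w k.-1 < size P) && (size (nth [::] P (w k.-1)) == old_len md).
  by move: old iE; rewrite /w eqxx andbT; case: eqP => //= _ + /eqP <-.
rewrite old' xP ux /=; rewrite (instE (w 0) x0 (w k.-1) i) //.
  by rewrite /w; move: iE; case: eqP => //= _; rewrite eqxx eq_sym.
by case/orP: old' => [->//|/andP[_ ->]]; rewrite orbT.
Qed.

Lemma exec_emit M o P : bounded_cover G k P -> represents M P ->
  exec G (emit k) (M, o) (fun s' => s'.2 = o ++ encode_coll P /\ represents s'.1 P).
Proof.
move=> bP rep; have [[pP kP uP] sP] := bP; have [[hN hL hR] _] := rep.
have Pn : size P <= n by have := size_bounded_cover k0 bP.1; rewrite card_ord.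
apply: exec_seq; apply: exec_weaken.
  apply: (@exec_for n G (fun i s => s.2 = o ++ flatten [seq encode_path p | p <- take i P] /\
    forall a, a != aOut -> s.1 a =1 M a)).
  - by rewrite /= !orbF; apply: modifies_seqc => i.
  - by rewrite take0 cats0; split=> //= a ao j; rewrite update_other.
  - move=> i [M1 o1] il /= v1 [/= oE off]; apply: exec_if => /=.
      rewrite v1 off // hN rows_size => iP; have {iP} iP : i < size P by case: ltnP iP.
      apply: exec_seq; apply: exec_weaken.
        apply: (@exec_iota n G _ (fun j s => s.1 = M1 /\
          s.2 = o1 ++ take j [seq val v | v <- nth [::] P i])); first by rewrite take0 cats0.
        move=> j [M2 o2] jk [/= -> ->]; apply: exec_if => /=.
          rewrite v1 off // hL ?rows_size // nth_rows // => jl.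
          have {jl} jl : j < size [seq val v | v <- nth [::] P i] by case: ltnP jl.
          apply: exec_write; split=> //=.
          rewrite v1 off; last by arrays.
          by rewrite hR ?rows_size // ?nth_rows // (take_nth 0) // rcons_cat.
        rewrite v1 off // hL ?rows_size // nth_rows // => jl.
        have {jl} jl : size [seq val v | v <- nth [::] P i] <= j by case: ltnP jl.
        by apply: exec_skip; rewrite !take_oversize // ltnW.
      move=> [M2 o2] [/= -> ->]; apply: exec_write; split=> /=; last first.
        by move=> a ao j; rewrite update_other ?off.
      rewrite take_oversize; last first.
        by rewrite size_map ltnW // (allP sP) // mem_nth.
      rewrite (take_nth [::]) // map_rcons flatten_rcons oE.
      by rewrite rcons_cat catA.
    rewrite v1 off // hN rows_size => iP; have {iP} iP : size P <= i by case: ltnP iP.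
    apply: exec_skip; split=> /=; last by move=> a ao j; rewrite update_other ?off.
    by rewrite oE !take_oversize // ltnW.
move=> [M1 o1] [/= -> off]; apply: exec_write; split=> /=.
  by rewrite take_oversize // rcons_cat.
split; first by apply: stored_eq (proj1 rep) => [i j|j|j]; rewrite off //; arrays.
by move=> v; rewrite off // (proj2 rep).
Qed.

Lemma exec_approx1 : exec G (approx1 k) (fun _ _ => 0, [::])
  (fun s' => exists tr P, complete_execution G k tr P /\ s'.2 = encode_trace tr).
Proof.
apply: exec_seq; apply: exec_write => /=.
(* A round covers a further vertex or finds nothing. After [n] rounds the first alternative says
   that everything is covered, so no operation can gain. *)
apply: exec_weaken; first apply: (@exec_for n G (fun r s => exists tr P,
  [/\ execution G k tr P, represents s.1 P, s.2 = encode_trace tr &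
      r <= #|covered P| \/ ~ exists Q, operation G k P Q])).
- have cR : control aRound by [].
  rewrite /= !negb_or modifies_search //=.
  by rewrite !andbT; apply: modifies_seqc.
- exists [:: [::]], [::]; split=> //; first exact: ExecStart.
  by left.
- move=> r [M o] rn _ [tr [P [ex rep /= oE prog]]].
  have bP := execution_bounded_cover k0 ex.
  apply: exec_seq; apply: exec_set => /=.
  set M1 := update M aFound 0 0.
  have s1 : searching P M1.
    by left.
  (* At level [k] no variable is fixed from outside, so any assignment will do; [r < n] supplies a
     vertex. *)
  pose w := fun _ : nat => Ordinal rn.
  apply: exec_seq.
  have noj j : k <= j < k -> M1 (aVar j) 0 = w j by move=> /andP[kj jk]; have := leq_ltn_trans kj jk; rewrite ltnn.
  apply: exec_weaken (exec_search o (leqnn k) bP noj s1) _ => -[M2 o2] [/= -> s2 none].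
  apply: exec_if => /= f.
    case: s2 => [[f0]|[_ [P' PP' rep']]]; first by rewrite f0 in f.
    have [bP' lt] := round_bounded_cover k0 bP PP'.
    apply: exec_weaken (exec_emit o bP' rep') _ => -[M3 o3] [/= -> rep3].
    exists (rcons tr P'), P'; split.
    + exact: ExecRound ex PP'.
    + exact: represents_update.
    + by rewrite oE /encode_trace map_rcons flatten_rcons.
    + left; case: prog => [le|stuck]; first exact: leq_ltn_trans le lt.
      by case: stuck; case: PP' => P1 [P2 [op _ _ _]]; exists P1.
  apply: exec_skip; exists tr, P; split=> //=.
    by case: s2 => [[_ rep2]|[]]; [apply: represents_update|rewrite f].
  right; apply: (searched_stuck (Ordinal rn) bP) => w'.
  have [_] := none f; apply => j /andP[kj jk]; by have := leq_ltn_trans kj jk; rewrite ltnn.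
move=> [M o] [tr [P [ex _ /= oE prog]]]; exists tr, P; split=> //; split=> //.
case: prog => // le [Q op]; have bP := execution_bounded_cover k0 ex.
have [cQ lt] := operation_cover k0 bP op.
have := leq_trans (leq_ltn_trans le _) (max_card (mem (covered Q))).
rewrite card_ord ltnn => /(_ _)/negP; apply=> //.
by rewrite (card_covered cQ) (card_covered bP.1).
Qed.

End Run.

Lemma approx1_time k : 0 < k -> runs_in_time k (fun n => n ^ k.+1).
Proof.
move=> k0; have [C HC] := time_bound_poly (approx1 k).
exists (approx1 k), C => n G; have [t [[M o] [r le [tr [P [ce /= oE]]]]]] := exec_approx1 G k0.
exists tr, P, t, M; split=> //; first by rewrite -oE.
by apply: leq_trans le _; rewrite -(loop_depth_approx1 k0).
Qed.

Local Open Scope ring_scope.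

Theorem theorem1 (R : rcfType) (k : nat) (hk : (4 <= k)%N) :
  [/\ runs_in_time k (fun n => n ^ k.+1)%N,
      terminating k
    & approximation_ratio k (rho R k)]
  /\ approximation_ratio 4 (12 / 5 : R)
  /\ ratio_attained 4 (12 / 5 : R).
Proof.
have k0 : (0 < k)%N by apply: leq_trans hk.
have k2 : (2 <= k)%N by apply: leq_trans hk.
split; last by split; [exact: approx1_ratio4|exact: ratio4_attained].
split; [exact: approx1_time|exact: approx1_terminating|exact: approx1_ratio].
Qed.
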